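(* The bicyclic semigroup $\mathcal C(p,q)$ is (algebraically isomorphic to) a subsemigroup of some Tychonoff countably pracompact topological semigroup.
   Context: The bicyclic semigroup $\mathcal C(p,q)$ is the semigroup with identity generated by $p,q$ subject to the single relation $qp=1$. A space $X$ is countably pracompact if there is a dense subset $A\subset X$ such that every infinite subset of $A$ has an accumulation point in $X$. A topological semigroup is a Hausdorff space with a jointly continuous associative operation. *)

(* Defs.v *)
From Stdlib Require Import Reals Arith List.
Open Scope R_scope.

Record topology (X : Type) := Topology {
  is_open : (X -> Prop) -> Prop;
  open_full : is_open (fun _ => True);
  open_empty : is_open (fun _ => False);
  open_union : forall (I : Type) (U : I -> X -> Prop),
      (forall i, is_open (U i)) -> is_open (fun x => exists i, U i x);
  open_inter : forall U V, is_open U -> is_open V -> is_open (fun x => U x /\ V x)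
}.
Arguments is_open {X} t U.

Definition is_closed {X : Type} (t : topology X) (F : X -> Prop) : Prop :=
  is_open t (fun x => ~ F x).

Definition R_open (U : R -> Prop) : Prop :=
  forall x, U x -> exists eps, 0 < eps /\ forall y, Rabs (y - x) < eps -> U y.

Definition continuous_R {X : Type} (t : topology X) (f : X -> R) : Prop :=
  forall U, R_open U -> is_open t (fun x => U (f x)).

Definition hausdorff {X : Type} (t : topology X) : Prop :=
  forall x y : X, x <> y -> exists U V, is_open t U /\ is_open t V /\ U x /\ V y /\
    (forall z, ~ (U z /\ V z)).

(** Tychonoff = T1 + completely regular (Engelking's convention). *)
Definition tychonoff {X : Type} (t : topology X) : Prop :=
  (forall x : X, is_closed t (fun y => y = x)) /\
  (forall (F : X -> Prop) (x : X), is_closed t F -> ~ F x ->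
     exists f : X -> R, continuous_R t f /\
       (forall y, 0 <= f y <= 1) /\ f x = 0 /\ (forall y, F y -> f y = 1)).

Definition dense {X : Type} (t : topology X) (A : X -> Prop) : Prop :=
  forall U, is_open t U -> (exists x, U x) -> exists a, U a /\ A a.

Definition finite_set {X : Type} (B : X -> Prop) : Prop :=
  exists l : list X, forall x, B x -> In x l.
Definition infinite_set {X : Type} (B : X -> Prop) : Prop := ~ finite_set B.

Definition accumulation_point {X : Type} (t : topology X) (B : X -> Prop) (x : X) : Prop :=
  forall U, is_open t U -> U x -> exists b, B b /\ U b /\ b <> x.

Definition countably_pracompact {X : Type} (t : topology X) : Prop :=
  exists A : X -> Prop, dense t A /\
    forall B : X -> Prop, (forall b, B b -> A b) -> infinite_set B ->
      exists x, accumulation_point t B x.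

Definition prod_open {X Y : Type} (tX : topology X) (tY : topology Y)
  (W : X * Y -> Prop) : Prop :=
  forall z, W z -> exists U V, is_open tX U /\ is_open tY V /\ U (fst z) /\ V (snd z) /\
    (forall x y, U x -> V y -> W (x, y)).

Definition jointly_continuous {X : Type} (t : topology X) (m : X -> X -> X) : Prop :=
  forall W, is_open t W -> prod_open t t (fun z => W (m (fst z) (snd z))).

Definition topological_semigroup {S : Type} (t : topology S) (m : S -> S -> S) : Prop :=
  hausdorff t /\ jointly_continuous t m /\
  (forall x y z, m x (m y z) = m (m x y) z).

(** * The bicyclic semigroup C(p,q)
    Every element of <p,q | qp = 1> has a unique normal form p^a q^b; we
    represent it by (a, b) : nat * nat.  Then
      p^a q^b . p^c q^d = p^(a+c-min(b,c)) q^(b+d-min(b,c)). *)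
Definition bicyclic := (nat * nat)%type.
Definition bicyclic_mul (x y : bicyclic) : bicyclic :=
  let (a, b) := x in let (c, d) := y in
  ((a + c - Nat.min b c)%nat, (b + d - Nat.min b c)%nat).

(* Main.v *)
Require Import Defs.
From Stdlib Require Import Reals Arith List ZArith Lia Lra.
From Stdlib Require Import Classical ClassicalEpsilon FunctionalExtensionality.
From Stdlib Require Import ProofIrrelevance Cantor.
From Coquelicot Require Import Complex.
From mathcomp Require classical_sets filter.
Open Scope R_scope.

(** Let [K] be the group of all functions from [R] to the unit circle with the topology of
    pointwise convergence, and [chi : Z -> K] the injective homomorphism
    [chi m = (theta |-> exp (i m theta))].  Suppose that [P] is a subset of the closure of
    [chi Z] which is closed under products and under multiplication by [chi Z], is disjoint from
    [chi Z], and contains an accumulation point of [chi B] for every infinite [B] in [Z].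
    On the disjoint union of [C(p,q)], [chi Z] and [P], let [p^a q^b] act as [chi (a - b)].
    Declare the elements of [C(p,q)] isolated, let [p^a q^b] with [a - b = k] converge to [chi k],
    and let the neighbourhoods of a point of [P] be those of [K] (with [p^a q^b] placed at
    [chi (a - b)]).  The product of two points of [P] never lies in [chi Z], so [a - b]
    leaves every finite set as [p^a q^b] approaches it; this makes multiplication jointly
    continuous.  [C(p,q)] is dense, and each of its infinite subsets accumulates, either
    in [chi Z] when [a - b] takes some value infinitely often, or in [P].

    To find [P], choose one accumulation point for each sufficiently lacunary sequence of integers
    in such a way that no non-empty product of chosen points is in [chi Z]; a maximal partial
    choice exists by Zorn's lemma.  It is total, because the equations to be avoided by a new
    point can be indexed by functions [nat -> nat], while the accumulation points of a lacunary
    sequence [d] are rich enough for a diagonal argument against such a list: [theta] can be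
    prescribed so that [d i * theta] follows any given sequence modulo [2 PI], and there is an
    independent family of subsets of [nat] indexed by [nat -> nat]. *)

(** * Topologies induced by real-valued functions *)

Definition near {X : Type} (l : list (X -> R)) (eps : R) (x y : X) : Prop :=
  forall f, In f l -> Rabs (f y - f x) < eps.

(** The filter of all neighbourhoods, open or not, so that local arguments need no proof of
    openness; [nbhd_interior] supplies an open set at the end. *)
Definition nbhd {X : Type} (Fam : (X -> R) -> Prop) (x : X) (U : X -> Prop) : Prop :=
  exists l eps, 0 < eps /\ (forall f, In f l -> Fam f) /\
    forall y, near l eps x y -> U y.

Lemma nbhd_sub {X : Type} (Fam : (X -> R) -> Prop) (x : X) (U V : X -> Prop) :
  nbhd Fam x U -> (forall y, U y -> V y) -> nbhd Fam x V.
Proof. intros (l & eps & H0 & Hl & HU) H. exists l, eps. auto. Qed.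

Lemma nbhd_full {X : Type} (Fam : (X -> R) -> Prop) (x : X) : nbhd Fam x (fun _ => True).
Proof. exists nil, 1. repeat split; [lra | intros f []]. Qed.

Lemma nbhd_inter {X : Type} (Fam : (X -> R) -> Prop) (x : X) (U V : X -> Prop) :
  nbhd Fam x U -> nbhd Fam x V -> nbhd Fam x (fun y => U y /\ V y).
Proof.
  intros (l & e & He & Hl & HU) (l' & e' & He' & Hl' & HV).
  exists (l ++ l'), (Rmin e e'). split; [apply Rmin_pos; assumption | split].
  - intros f Hf. apply in_app_or in Hf. destruct Hf; auto.
  - intros y Hy. split; [apply HU | apply HV]; intros f Hf;
      (eapply Rlt_le_trans; [apply Hy; apply in_or_app; auto | ]).
    + apply Rmin_l.
    + apply Rmin_r.
Qed.

Lemma nbhd_all {X A : Type} (Fam : (X -> R) -> Prop) (x : X) (U : A -> X -> Prop)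
  (l : list A) :
  (forall a, In a l -> nbhd Fam x (U a)) ->
  nbhd Fam x (fun y => forall a, In a l -> U a y).
Proof.
  induction l as [|a l IH]; intros H.
  - eapply nbhd_sub; [apply nbhd_full | intros y _ a []].
  - apply nbhd_sub with (fun y => U a y /\ forall b, In b l -> U b y).
    + apply nbhd_inter; [apply H; left; reflexivity | apply IH].
      intros b Hb. apply H. right. exact Hb.
    + intros y [Ha Hl] b [<- | Hb]; auto.
Qed.

Lemma nbhd_fun {X : Type} (Fam : (X -> R) -> Prop) (x : X) (f : X -> R) (eps : R) :
  Fam f -> 0 < eps -> nbhd Fam x (fun y => Rabs (f y - f x) < eps).
Proof.
  intros Hf He. exists (f :: nil), eps. split; [exact He | split].
  - intros g [<- | []]. exact Hf.
  - intros y Hy. apply Hy. left. reflexivity.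
Qed.

Definition initial_open {X : Type} (Fam : (X -> R) -> Prop) (U : X -> Prop) : Prop :=
  forall x, U x -> nbhd Fam x U.

Definition initial_topology {X : Type} (Fam : (X -> R) -> Prop) : topology X.
Proof.
  apply (Topology X (initial_open Fam)).
  - intros x _. apply nbhd_full.
  - intros x [].
  - intros I U HU x [i Hi]. apply nbhd_sub with (U i); [apply HU; exact Hi | ].
    intros y Hy. exists i. exact Hy.
  - intros U V HU HV x [Hx Hx']. apply nbhd_inter; auto.
Defined.

Lemma near_open {X : Type} (Fam : (X -> R) -> Prop) (l : list (X -> R)) (eps : R) (x : X) :
  (forall f, In f l -> Fam f) -> is_open (initial_topology Fam) (near l eps x).
Proof.
  intros Hl y Hy.
  apply (nbhd_all Fam y (fun f z => Rabs (f z - f x) < eps) l).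
  intros f Hf. specialize (Hy f Hf).
  apply nbhd_sub with (fun z => Rabs (f z - f y) < eps - Rabs (f y - f x)).
  - apply nbhd_fun; [auto | lra].
  - intros z Hz. replace (f z - f x) with ((f z - f y) + (f y - f x)) by ring.
    eapply Rle_lt_trans; [apply Rabs_triang | lra].
Qed.

Lemma nbhd_interior {X : Type} (Fam : (X -> R) -> Prop) (x : X) (U : X -> Prop) :
  nbhd Fam x U ->
  exists V, is_open (initial_topology Fam) V /\ V x /\ forall y, V y -> U y.
Proof.
  intros (l & eps & He & Hl & HU). exists (near l eps x). split; [ | split].
  - apply near_open. exact Hl.
  - intros f _. rewrite Rminus_diag, Rabs_R0. exact He.
  - exact HU.
Qed.

Lemma initial_continuous {X : Type} (Fam : (X -> R) -> Prop) (f : X -> R) :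
  (forall x eps, 0 < eps -> nbhd Fam x (fun y => Rabs (f y - f x) < eps)) ->
  continuous_R (initial_topology Fam) f.
Proof.
  intros Hf U HU x Hx. destruct (HU _ Hx) as (eps & He & H).
  apply nbhd_sub with (1 := Hf x eps He). intros y Hy. apply H, Hy.
Qed.

Definition separates {X : Type} (Fam : (X -> R) -> Prop) : Prop :=
  forall x y : X, x <> y -> exists f, Fam f /\ f x <> f y.

Lemma initial_hausdorff {X : Type} (Fam : (X -> R) -> Prop) :
  separates Fam -> hausdorff (initial_topology Fam).
Proof.
  intros Hs x y Hxy. destruct (Hs x y Hxy) as (f & Hf & Hne).
  assert (Hd : 0 < Rabs (f x - f y)) by (apply Rabs_pos_lt; lra).
  exists (near (f :: nil) (Rabs (f x - f y) / 2) x), (near (f :: nil) (Rabs (f x - f y) / 2) y).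
  assert (HF : forall g, In g (f :: nil) -> Fam g) by (intros g [<- | []]; exact Hf).
  split; [apply near_open; exact HF | ].
  split; [apply near_open; exact HF | ].
  split; [intros g _; rewrite Rminus_diag, Rabs_R0; lra | ].
  split; [intros g _; rewrite Rminus_diag, Rabs_R0; lra | ].
  intros z [Hz Hz'].
  specialize (Hz f (or_introl eq_refl)). specialize (Hz' f (or_introl eq_refl)).
  rewrite Rabs_minus_sym in Hz.
  pose proof (Rabs_triang (f x - f z) (f z - f y)) as H.
  replace (f x - f z + (f z - f y)) with (f x - f y) in H by ring. lra.
Qed.

Fixpoint deviation {X : Type} (l : list (X -> R)) (x y : X) : R :=
  match l with
  | nil => 0
  | f :: l' => Rmax (Rabs (f y - f x)) (deviation l' x y)
  end.

Lemma deviation_pos {X : Type} (l : list (X -> R)) (x y : X) : 0 <= deviation l x y.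
Proof.
  destruct l as [|f l]; simpl; [lra | ].
  eapply Rle_trans; [apply Rabs_pos | apply Rmax_l].
Qed.

Lemma deviation_diag {X : Type} (l : list (X -> R)) (x : X) : deviation l x x = 0.
Proof.
  induction l as [|f l IH]; simpl; [reflexivity | ].
  rewrite IH, Rminus_diag, Rabs_R0. apply Rmax_left. lra.
Qed.

Lemma near_of_deviation {X : Type} (l : list (X -> R)) (x y : X) (eps : R) :
  deviation l x y < eps -> near l eps x y.
Proof.
  induction l as [|f l IH]; simpl; intros H g Hg; [destruct Hg | ].
  apply Rmax_Rlt in H. destruct Hg as [<- | Hg]; [apply H | ].
  apply IH; [apply H | exact Hg].
Qed.

Lemma deviation_lipschitz {X : Type} (l : list (X -> R)) (x y z : X) (eps : R) :
  0 < eps -> near l eps y z -> Rabs (deviation l x z - deviation l x y) < eps.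
Proof.
  intros He. induction l as [|f l IH]; simpl; intros H.
  - rewrite Rminus_diag, Rabs_R0. exact He.
  - assert (H1 : Rabs (f z - f y) < eps) by (apply H; left; reflexivity).
    assert (H2 : Rabs (deviation l x z - deviation l x y) < eps)
      by (apply IH; intros g Hg; apply H; right; exact Hg).
    pose proof (Rabs_triang_inv2 (f z - f x) (f y - f x)) as H3.
    replace (f z - f x - (f y - f x)) with (f z - f y) in H3 by ring.
    assert (H4 : Rabs (Rabs (f z - f x) - Rabs (f y - f x)) < eps) by lra.
    revert H2 H4. generalize (Rabs (f z - f x)) (Rabs (f y - f x)).
    generalize (deviation l x z) (deviation l x y). clear.
    intros a b c d. unfold Rmax.
    destruct (Rle_dec c a), (Rle_dec d b); intros H1 H2;
      apply Rabs_def2 in H1; apply Rabs_def2 in H2; apply Rabs_def1; lra.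
Qed.

(** If [F] misses the basic neighbourhood [near l eps x], then [deviation l x] is at least [eps] on
    [F]; divided by [eps] and truncated at 1, it separates [x] from [F]. *)
Lemma initial_tychonoff {X : Type} (Fam : (X -> R) -> Prop) :
  separates Fam -> tychonoff (initial_topology Fam).
Proof.
  intros Hs. split.
  - intros x y Hyx. destruct (Hs y x Hyx) as (f & Hf & Hne).
    apply nbhd_sub with (fun z => Rabs (f z - f y) < Rabs (f x - f y)).
    + apply nbhd_fun; [exact Hf | apply Rabs_pos_lt; lra].
    + intros z Hz ->. lra.
  - intros F x HF Hx. destruct (HF x Hx) as (l & eps & He & Hl & HU).
    exists (fun y => Rmin 1 (deviation l x y / eps)). split; [ | split; [ | split]].
    + apply initial_continuous. intros y eta Heta.
      apply nbhd_sub with (near l (eps * eta) y).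
      * apply (near_open Fam l (eps * eta) y Hl). intros f _.
        rewrite Rminus_diag, Rabs_R0. apply Rmult_lt_0_compat; assumption.
      * intros z Hz.
        assert (Hd : Rabs (deviation l x z - deviation l x y) < eps * eta)
          by (apply deviation_lipschitz; [apply Rmult_lt_0_compat | ]; assumption).
        assert (H : Rabs (deviation l x z / eps - deviation l x y / eps) < eta).
        { replace (deviation l x z / eps - deviation l x y / eps)
            with ((deviation l x z - deviation l x y) * / eps) by (field; lra).
          rewrite Rabs_mult, (Rabs_right (/ eps)) by (left; apply Rinv_0_lt_compat, He).
          apply Rmult_lt_reg_r with eps; [exact He | ].
          rewrite Rmult_assoc, Rinv_l, Rmult_1_r by lra. lra. }
        revert H. generalize (deviation l x z / eps) (deviation l x y / eps).
        intros a b H. apply Rabs_def2 in H. unfold Rmin.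
        destruct (Rle_dec 1 a), (Rle_dec 1 b); apply Rabs_def1; lra.
    + intros y. split; [ | apply Rmin_l]. apply Rmin_glb; [lra | ].
      apply Rmult_le_pos; [apply deviation_pos | left; apply Rinv_0_lt_compat, He].
    + rewrite deviation_diag. unfold Rdiv. rewrite Rmult_0_l. apply Rmin_right. lra.
    + intros y Hy. apply Rmin_left. apply Rnot_lt_le. intros Hlt.
      apply (HU y); [ | exact Hy]. apply near_of_deviation.
      apply Rmult_lt_compat_r with (r := eps) in Hlt; [ | exact He].
      unfold Rdiv in Hlt. rewrite Rmult_assoc, Rinv_l in Hlt by lra. lra.
Qed.

(** The functions of [Fam] give a subbase, so continuity can be tested on one of them at a time; the
    finitely many neighbourhoods obtained are then intersected. *)
Lemma initial_jointly_continuous {X : Type} (Fam : (X -> R) -> Prop) (m : X -> X -> X) :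
  (forall f, Fam f -> forall x y eps, 0 < eps -> exists U V,
     nbhd Fam x U /\ nbhd Fam y V /\
     forall x' y', U x' -> V y' -> Rabs (f (m x' y') - f (m x y)) < eps) ->
  jointly_continuous (initial_topology Fam) m.
Proof.
  intros Hm W HW [x y] Hxy. simpl in Hxy.
  destruct (HW _ Hxy) as (l & eps & He & Hl & HU).
  assert (H : exists U V, nbhd Fam x U /\ nbhd Fam y V /\
     forall x' y', U x' -> V y' -> near l eps (m x y) (m x' y')).
  { clear HU. induction l as [|f l IH].
    - exists (fun _ => True), (fun _ => True).
      repeat split; try apply nbhd_full. intros x' y' _ _ f [].
    - destruct IH as (U & V & HU & HV & H); [intros g Hg; apply Hl; right; exact Hg | ].
      destruct (Hm f (Hl f (or_introl eq_refl)) x y eps He) as (U' & V' & HU' & HV' & H').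
      exists (fun z => U z /\ U' z), (fun z => V z /\ V' z).
      split; [apply nbhd_inter; assumption | ].
      split; [apply nbhd_inter; assumption | ].
      intros x' y' [Hx1 Hx2] [Hy1 Hy2] g [<- | Hg]; [apply H'; assumption | ].
      apply (H x' y'); assumption. }
  destruct H as (U & V & HUx & HVy & H).
  destruct (nbhd_interior _ _ _ HUx) as (U' & HU'o & HU'x & HU').
  destruct (nbhd_interior _ _ _ HVy) as (V' & HV'o & HV'y & HV').
  exists U', V'. repeat split; try assumption.
  intros x' y' Hx' Hy'. simpl. apply HU, H; auto.
Qed.

(** * Characters of the integers and lacunary sequences *)

Definition expi (t : R) : C := (cos t, sin t).

Lemma expi_add (s t : R) : expi (s + t) = (expi s * expi t)%C.
Proof. unfold expi, Cmult; simpl. rewrite cos_plus, sin_plus. f_equal; ring. Qed.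

Lemma expi_pow (t : R) (n : nat) : Cpow (expi t) n = expi (INR n * t).
Proof.
  induction n as [|n IH].
  - simpl. rewrite Rmult_0_l. unfold expi. rewrite cos_0, sin_0. reflexivity.
  - rewrite S_INR, Rmult_plus_distr_r, Rmult_1_l, Rplus_comm, expi_add, <- IH. reflexivity.
Qed.

Lemma Cmod_expi (t : R) : Cmod (expi t) = 1.
Proof.
  unfold Cmod, expi; simpl. pose proof (sin2_cos2 t) as H. unfold Rsqr in H.
  replace (cos t * (cos t * 1) + sin t * (sin t * 1)) with 1 by lra. apply sqrt_1.
Qed.

Lemma expi_neq_0 (t : R) : expi t <> 0%C.
Proof. intros H. pose proof (Cmod_expi t) as H1. rewrite H, Cmod_0 in H1. lra. Qed.

Lemma expi_PI : expi PI = (- 1)%C.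
Proof. unfold expi. rewrite cos_PI, sin_PI. apply injective_projections; simpl; ring. Qed.

Lemma cos_period_Z (t : R) (k : Z) : cos (t + 2 * PI * IZR k) = cos t.
Proof.
  destruct k as [|k|k].
  - f_equal. ring.
  - rewrite <- (cos_period t (Pos.to_nat k)), INR_IZR_INZ, positive_nat_Z. f_equal. ring.
  - rewrite <- (cos_period (t + 2 * PI * IZR (Z.neg k)) (Pos.to_nat k)), INR_IZR_INZ.
    rewrite positive_nat_Z. f_equal. change (Z.neg k) with (- Z.pos k)%Z. rewrite opp_IZR. ring.
Qed.

Lemma sin_period_Z (t : R) (k : Z) : sin (t + 2 * PI * IZR k) = sin t.
Proof.
  rewrite !sin_cos. f_equal.
  replace (PI / 2 + (t + 2 * PI * IZR k)) with ((PI / 2 + t) + 2 * PI * IZR k) by ring.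
  apply cos_period_Z.
Qed.

Lemma expi_lipschitz (s t : R) : Cmod (expi s - expi t) <= Rabs (s - t).
Proof.
  (* The chord between the two points has length [2 * Rabs (sin b)], where [b] is half the
     difference of the angles. *)
  set (a := (s + t) / 2). set (b := (s - t) / 2).
  assert (Hs : s = a + b) by (unfold a, b; field).
  assert (Ht : t = a - b) by (unfold a, b; field).
  clearbody a b. subst s t.
  replace (Rabs (a + b - (a - b))) with (2 * Rabs b).
  2: { replace (a + b - (a - b)) with (2 * b) by ring. rewrite Rabs_mult, (Rabs_right 2); lra. }
  assert (H : Cmod (expi (a + b) - expi (a - b)) = 2 * Rabs (sin b)).
  { unfold Cmod, expi, Cminus, Cplus, Copp; simpl.
    rewrite cos_plus, cos_minus, sin_plus, sin_minus.
    replace (2 * Rabs (sin b)) with (Rabs (2 * sin b)) by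
      (rewrite Rabs_mult, (Rabs_right 2); lra).
    rewrite <- sqrt_Rsqr_abs. f_equal. unfold Rsqr.
    pose proof (sin2_cos2 a) as H. unfold Rsqr in H.
    transitivity (4 * (sin b * sin b) * (sin a * sin a + cos a * cos a)); [ring | ].
    rewrite H. ring. }
  rewrite H. apply Rmult_le_compat_l; [lra | ].
  destruct (Rle_dec 0 b) as [Hb | Hb].
  - destruct (Req_dec b 0) as [-> | Hb0]; [rewrite sin_0; lra | ].
    apply Rabs_le. rewrite Rabs_right by lra.
    pose proof (sin_lt_x b). pose proof (sin_lt_x (-b)).
    destruct (Rle_dec b PI).
    + pose proof (sin_ge_0 b). lra.
    + pose proof (SIN_bound b). pose proof PI_RGT_0. pose proof PI2_1. lra.
  - rewrite (Rabs_left b) by lra. apply Rabs_le.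
    pose proof (sin_lt_x (-b)) as H1. rewrite sin_neg in H1.
    destruct (Rle_dec (-b) PI).
    + pose proof (sin_ge_0 (-b)) as H2. rewrite sin_neg in H2. lra.
    + pose proof (SIN_bound b). pose proof PI_RGT_0. pose proof PI2_1. lra.
Qed.

(* Values of modulus other than [1] are allowed: inverses in [K] are not needed. *)
Definition cfun := R -> C.
Definition fmul (g h : cfun) : cfun := fun th => (g th * h th)%C.
Definition chi (m : Z) : cfun := fun th => expi (IZR m * th).

Lemma fmul_assoc (g h k : cfun) : fmul g (fmul h k) = fmul (fmul g h) k.
Proof. apply functional_extensionality. intros th. unfold fmul. ring. Qed.

Lemma fmul_comm (g h : cfun) : fmul g h = fmul h g.
Proof. apply functional_extensionality. intros th. unfold fmul. ring. Qed.

Lemma chi_add (m n : Z) : chi (m + n) = fmul (chi m) (chi n).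
Proof.
  apply functional_extensionality. intros th. unfold chi, fmul.
  rewrite plus_IZR, Rmult_plus_distr_r. apply expi_add.
Qed.

Lemma fmul_chi_0 (g : cfun) : fmul (chi 0) g = g.
Proof.
  apply functional_extensionality. intros th. unfold chi, fmul, expi.
  rewrite Rmult_0_l, cos_0, sin_0. change (1, 0) with (RtoC 1). ring.
Qed.

Lemma fmul_chi_cancel (m : Z) (g h : cfun) : fmul (chi m) g = h -> g = fmul (chi (- m)) h.
Proof.
  intros <-. rewrite fmul_assoc, <- chi_add, Z.add_opp_diag_l, fmul_chi_0. reflexivity.
Qed.

Lemma chi_inj (m n : Z) : chi m = chi n -> m = n.
Proof.
  intros H. destruct (Z.eq_dec m n) as [E | E]; [exact E | exfalso].
  assert (H0 : chi (m - n) = chi 0).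
  { unfold Z.sub. rewrite chi_add, H, <- chi_add. f_equal. lia. }
  (* At this angle [chi (m - n)] is -1 while [chi 0] is 1. *)
  apply (f_equal (fun g => g (PI / IZR (m - n)))) in H0. unfold chi in H0.
  assert (Hne : IZR (m - n) <> 0) by (apply not_0_IZR; lia).
  replace (IZR (m - n) * (PI / IZR (m - n))) with PI in H0 by (field; exact Hne).
  unfold expi in H0. rewrite cos_PI, Rmult_0_l, cos_0 in H0.
  injection H0. intros; lra.
Qed.

Lemma cfun_neq (g h : cfun) : g <> h -> exists th, g th <> h th.
Proof.
  intros H. apply not_all_ex_not. intros H'. apply H.
  apply functional_extensionality. exact H'.
Qed.

Lemma Cmod_minus_pos (z w : C) : z <> w -> 0 < Cmod (z - w).
Proof.
  intros H. apply Cmod_gt_0. intros H0. apply H.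
  replace z with ((z - w) + w)%C by ring. rewrite H0. ring.
Qed.

Lemma Cmod_minus_sym (z w : C) : Cmod (z - w) = Cmod (w - z).
Proof. rewrite <- Cmod_opp. f_equal. ring. Qed.

Lemma Cmod_minus_triangle (u v w : C) : Cmod (u - w) <= Cmod (u - v) + Cmod (v - w).
Proof. replace (u - w)%C with ((u - v) + (v - w))%C by ring. apply Cmod_triangle. Qed.

Lemma Cmod_dist_lipschitz (u v w : C) : Rabs (Cmod (u - w) - Cmod (v - w)) <= Cmod (u - v).
Proof.
  pose proof (Cmod_minus_triangle u v w). pose proof (Cmod_minus_triangle v u w) as H1.
  rewrite (Cmod_minus_sym v u) in H1. apply Rabs_le. lra.
Qed.

Lemma Cmult_continuous (z w : C) (eps : R) : 0 < eps -> exists delta, 0 < delta /\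
  forall z' w', Cmod (z' - z) < delta -> Cmod (w' - w) < delta ->
    Cmod (z' * w' - z * w) < eps.
Proof.
  (* If both factors move by less than [d <= 1], the product moves by less than [d * M]: the mixed
     term costs [d], the two linear terms [d * Cmod w] and [d * Cmod z]. *)
  intros He. set (M := 1 + Cmod z + Cmod w).
  pose proof (Cmod_ge_0 z) as Hz. pose proof (Cmod_ge_0 w) as Hw.
  assert (HM : 0 < M) by (unfold M; lra).
  exists (Rmin 1 (eps / M)).
  assert (HeM : 0 < eps / M) by (apply Rdiv_lt_0_compat; assumption).
  split; [apply Rmin_pos; lra | ]. intros z' w' H1 H2.
  replace (z' * w' - z * w)%C with ((z' - z) * (w' - w) + (z' - z) * w + z * (w' - w))%C by ring.
  eapply Rle_lt_trans; [apply Cmod_triangle | ].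
  eapply Rle_lt_trans; [apply Rplus_le_compat_r, Cmod_triangle | ].
  rewrite !Cmod_mult.
  pose proof (Rmin_l 1 (eps / M)) as L1. pose proof (Rmin_r 1 (eps / M)) as L2.
  set (d := Rmin 1 (eps / M)) in *.
  pose proof (Cmod_ge_0 (z' - z)) as P1. pose proof (Cmod_ge_0 (w' - w)) as P2.
  set (a := Cmod (z' - z)) in *. set (b := Cmod (w' - w)) in *.
  assert (Hd : 0 < d) by lra.
  assert (HdM : d * M <= eps).
  { replace eps with (eps / M * M) by (field; lra).
    apply Rmult_le_compat_r; lra. }
  assert (E1 : a * b <= a * 1) by (apply Rmult_le_compat_l; lra).
  assert (E2 : a * Cmod w <= d * Cmod w) by (apply Rmult_le_compat_r; lra).
  assert (E3 : Cmod z * b <= d * Cmod z).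
  { rewrite Rmult_comm. apply Rmult_le_compat_r; lra. }
  unfold M in HdM. lra.
Qed.

(** * The pointwise closure of the integer characters *)

Definition in_closure (g : cfun) : Prop :=
  forall ths eps, 0 < eps -> exists m, forall th, In th ths -> Cmod (chi m th - g th) < eps.

Lemma list_delta {A : Type} (l : list A) (Q : A -> R -> Prop) :
  (forall a, In a l -> exists d, 0 < d /\ Q a d) ->
  (forall a d d', 0 < d' <= d -> Q a d -> Q a d') ->
  exists d, 0 < d /\ forall a, In a l -> Q a d.
Proof.
  intros H Hm. induction l as [|a l IH].
  - exists 1. split; [lra | intros a []].
  - destruct IH as (d & Hd & HQ); [intros b Hb; apply H; right; exact Hb | ].
    destruct (H a (or_introl eq_refl)) as (d' & Hd' & HQ').
    exists (Rmin d d'). assert (Hmin : 0 < Rmin d d') by (apply Rmin_pos; assumption).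
    split; [exact Hmin | ].
    intros b [<- | Hb].
    + apply Hm with d'; [split; [exact Hmin | apply Rmin_r] | exact HQ'].
    + apply Hm with d; [split; [exact Hmin | apply Rmin_l] | auto].
Qed.

Lemma in_closure_mul (g h : cfun) : in_closure g -> in_closure h -> in_closure (fmul g h).
Proof.
  intros Hg Hh ths eps He.
  destruct (list_delta ths (fun th d => forall z' w', Cmod (z' - g th) < d ->
    Cmod (w' - h th) < d -> Cmod (z' * w' - g th * h th) < eps)) as (d & Hd & H).
  - intros th _. apply Cmult_continuous, He.
  - intros th d d' Hd H z' w' H1 H2. apply H; lra.
  - destruct (Hg ths d Hd) as [m Hm]. destruct (Hh ths d Hd) as [n Hn].
    exists (m + n)%Z. intros th Hth. rewrite chi_add. apply H; auto.
Qed.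

Lemma in_closure_chi (m : Z) : in_closure (chi m).
Proof.
  intros ths eps He. exists m. intros th _.
  replace (chi m th - chi m th)%C with (RtoC 0) by ring. rewrite Cmod_0. exact He.
Qed.

(** The lower bound on the ratios grows with [i] instead of being a constant, so that the error in
    [sparse_interpolation] tends to 0. *)
Definition sparse (d : nat -> Z) : Prop :=
  forall i, d i <> 0%Z /\ (Z.of_nat (i + 2) * Z.abs (d i) <= Z.abs (d (S i)))%Z.

Lemma sparse_ge (d : nat -> Z) : sparse d -> forall i, (Z.of_nat i < Z.abs (d i))%Z.
Proof. intros Hd. induction i as [|i IH]; [destruct (Hd O) | destruct (Hd i)]; nia. Qed.

Lemma sparse_subsequence (B : Z -> Prop) :
  (forall N, exists m, B m /\ (N < Z.abs m)%Z) ->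
  exists d, sparse d /\ forall i, B (d i).
Proof.
  intros HB.
  pose (next := fun N => proj1_sig (constructive_indefinite_description _ (HB N))).
  assert (Hnext : forall N, B (next N) /\ (N < Z.abs (next N))%Z)
    by (intros N; exact (proj2_sig (constructive_indefinite_description _ (HB N)))).
  pose (d := fix d (i : nat) : Z := match i with
    | O => next 0%Z
    | S i => next (Z.of_nat (i + 2) * Z.abs (d i))%Z
    end).
  exists d. split.
  - intros i. split.
    + assert (H : (0 < Z.abs (d i))%Z); [ | lia].
      destruct i as [|i]; simpl; [apply Hnext | ].
      eapply Z.le_lt_trans; [ | apply Hnext]. lia.
    + apply Z.lt_le_incl. exact (proj2 (Hnext _)).
  - intros [|i]; simpl; apply Hnext.
Qed.

(** Over an interval of length [2 * PI / Rabs D], multiplication by [D] makes a full turn. As [c]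
    must be non-negative, the number of turns [r] is rounded up for positive [D] and down for
    negative [D]. *)
Lemma hit_target (D y f : R) : D <> 0 ->
  exists c, 0 <= c <= 2 * PI / Rabs D /\ exists k, D * (y + c) = f + 2 * PI * IZR k.
Proof.
  intros HD. pose proof PI_RGT_0 as Hpi.
  set (r := (D * y - f) / (2 * PI)).
  assert (Hr : D * y = f + 2 * PI * r) by (unfold r; field; lra).
  destruct (archimed r) as [U1 U2].
  destruct (Rle_dec 0 D) as [HD0 | HD0].
  - rewrite Rabs_right by lra.
    exists ((2 * PI * (IZR (up r) - r)) / D). split.
    + split; [apply Rmult_le_pos; [nra | left; apply Rinv_0_lt_compat; lra] | ].
      apply Rmult_le_compat_r; [left; apply Rinv_0_lt_compat; lra | nra].
    + exists (up r). rewrite Rmult_plus_distr_l, Hr. field. exact HD.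
  - rewrite Rabs_left by lra.
    exists ((2 * PI * (r - (IZR (up r) - 1))) / - D). split.
    + split; [apply Rmult_le_pos; [nra | left; apply Rinv_0_lt_compat; lra] | ].
      apply Rmult_le_compat_r; [left; apply Rinv_0_lt_compat; lra | nra].
    + exists (up r - 1)%Z. rewrite Rmult_plus_distr_l, Hr, minus_IZR. field. exact HD.
Qed.

(* The partial sums are corrected at step [i] by at most [2 PI / |d i|], so that the later
   corrections move [d i * theta] by [O(1 / i)] only. *)
Lemma sparse_interpolation (d : nat -> Z) (f : nat -> R) : sparse d ->
  exists th, forall i, exists k,
    Rabs (IZR (d i) * th - (f i + 2 * PI * IZR k)) <= 4 * PI / INR (i + 2).
Proof.
  intros Hd. pose proof PI_RGT_0 as Hpi.
  assert (HD : forall i, IZR (d i) <> 0) by (intros i; apply not_0_IZR, Hd).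
  assert (Hstep : forall i y, exists c, 0 <= c <= 2 * PI / Rabs (IZR (d i)) /\
    exists k, IZR (d i) * (y + c) = f i + 2 * PI * IZR k)
    by (intros i y; apply hit_target, HD).
  pose (c := fun i y => proj1_sig (constructive_indefinite_description _ (Hstep i y))).
  assert (Hc : forall i y, 0 <= c i y <= 2 * PI / Rabs (IZR (d i)) /\
    exists k, IZR (d i) * (y + c i y) = f i + 2 * PI * IZR k)
    by (intros i y; exact (proj2_sig (constructive_indefinite_description _ (Hstep i y)))).
  pose (y := fix y (i : nat) : R := match i with O => 0 | S i => y i + c i (y i) end).
  assert (HA : forall i, 0 < Rabs (IZR (d i))) by (intros i; apply Rabs_pos_lt, HD).
  assert (HG : forall i, INR (i + 2) * Rabs (IZR (d i)) <= Rabs (IZR (d (S i)))).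
  { intros i. rewrite INR_IZR_INZ, <- !abs_IZR, <- mult_IZR. apply IZR_le, Hd. }
  assert (Hi2 : forall i, 2 <= INR (i + 2)).
  { intros i. rewrite plus_INR. pose proof (pos_INR i). simpl. lra. }
  (* The constant 4 makes the intervals from [y i] to [w i] nested: the correction at step [i] uses
     at most half of the margin, and the next margin is at most the other half, because the absolute
     values of [d] at least double. *)
  pose (w := fun i => y i + 4 * PI / Rabs (IZR (d i))).
  assert (Hinv : forall i, / Rabs (IZR (d (S i))) <= / INR (i + 2) * / Rabs (IZR (d i))).
  { intros i. rewrite <- Rinv_mult. apply Rinv_le_contravar; [ | apply HG].
    apply Rmult_lt_0_compat; [specialize (Hi2 i); lra | apply HA]. }
  assert (Hinv2 : forall i, / Rabs (IZR (d (S i))) <= / 2 * / Rabs (IZR (d i))).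
  { intros i. eapply Rle_trans; [apply Hinv | ].
    apply Rmult_le_compat_r; [left; apply Rinv_0_lt_compat, HA | ].
    apply Rinv_le_contravar; [lra | apply Hi2]. }
  assert (Hyup : forall i n, y i <= y (n + i)%nat).
  { intros i n. induction n as [|n IH]; [simpl; lra | ].
    change (y (S n + i)%nat) with (y (n + i)%nat + c (n + i)%nat (y (n + i)%nat)).
    destruct (Hc (n + i)%nat (y (n + i)%nat)) as [[H _] _]. lra. }
  assert (Hwdown : forall i n, w (n + i)%nat <= w i).
  { intros i n. induction n as [|n IH]; [simpl; lra | ].
    eapply Rle_trans; [ | exact IH]. unfold w.
    change (y (S n + i)%nat) with (y (n + i)%nat + c (n + i)%nat (y (n + i)%nat)).
    destruct (Hc (n + i)%nat (y (n + i)%nat)) as [[_ H] _].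
    specialize (Hinv2 (n + i)%nat). change (S n + i)%nat with (S (n + i)).
    unfold Rdiv in *. nra. }
  assert (Hyw : forall i, y i <= w i).
  { intros i. unfold w. assert (0 < 4 * PI / Rabs (IZR (d i))); [ | lra].
    apply Rdiv_lt_0_compat; [lra | apply HA]. }
  assert (Hbound : forall i n, y n <= w i).
  { intros i n. eapply Rle_trans; [apply (Hyup n i) | ].
    rewrite Nat.add_comm. eapply Rle_trans; [apply Hyw | apply Hwdown]. }
  destruct (completeness (fun r => exists n, r = y n)) as [th [Hub Hlub]].
  { exists (w O). intros r [n ->]. apply Hbound. }
  { exists (y O). exists O. reflexivity. }
  exists th. intros i. destruct (Hc i (y i)) as [_ [k Hk]]. exists k. rewrite <- Hk.
  (* At [y (S i)] the target is hit exactly modulo [2 * PI]; the remaining distance to [th] is at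
     most the margin of [w (S i)], which after multiplication by [d i] is at most
     [4 * PI / INR (i + 2)]. *)
  change (y i + c i (y i)) with (y (S i)).
  rewrite <- Rmult_minus_distr_l, Rabs_mult.
  assert (H1 : y (S i) <= th) by (apply Hub; exists (S i); reflexivity).
  assert (H2 : th <= w (S i)) by (apply Hlub; intros r [n ->]; apply Hbound).
  rewrite (Rabs_right (th - y (S i))) by lra.
  apply Rle_trans with (Rabs (IZR (d i)) * (4 * PI * (/ INR (i + 2) * / Rabs (IZR (d i))))).
  - apply Rmult_le_compat_l; [left; apply HA | ].
    unfold w, Rdiv in H2. specialize (Hinv i).
    apply Rle_trans with (4 * PI * / Rabs (IZR (d (S i)))); [lra | ].
    apply Rmult_le_compat_l; lra.
  - right. field. split; [specialize (Hi2 i); lra | specialize (HA i); lra].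
Qed.

(** * Independent sets and the diagonal argument *)

Fixpoint code_list (l : list nat) : nat :=
  match l with
  | nil => O
  | x :: l' => S (to_nat (x, code_list l'))
  end.

Lemma code_list_inj (l l' : list nat) : code_list l = code_list l' -> l = l'.
Proof.
  revert l'. induction l as [|x l IH]; intros [|x' l']; cbn [code_list]; intros H; try discriminate.
  - reflexivity.
  - apply Nat.succ_inj, to_nat_inj in H. injection H as -> H. rewrite (IH l' H). reflexivity.
Qed.

Definition code_Z (z : Z) : nat := to_nat (Z.to_nat z, Z.to_nat (- z)).

Lemma code_Z_inj (z z' : Z) : code_Z z = code_Z z' -> z = z'.
Proof. unfold code_Z. intros H. apply to_nat_inj in H. injection H. lia. Qed.

Definition prefix (s : nat -> nat) (N : nat) : nat := code_list (map s (seq 0 N)).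

Lemma eventually_all {A : Type} (l : list A) (Q : A -> nat -> Prop) :
  (forall a, In a l -> exists N0, forall N, (N0 <= N)%nat -> Q a N) ->
  exists N0, forall N, (N0 <= N)%nat -> forall a, In a l -> Q a N.
Proof.
  induction l as [|a l IH]; intros H.
  - exists O. intros N _ a [].
  - destruct IH as [N1 H1]; [intros b Hb; apply H; right; exact Hb | ].
    destruct (H a (or_introl eq_refl)) as [N2 H2].
    exists (Nat.max N1 N2). intros N HN b [<- | Hb]; [apply H2 | apply H1]; auto; lia.
Qed.

(** Two distinct functions have distinct prefixes beyond the first place where they differ, and only
    finitely many pairs have to be separated. *)
Lemma prefix_separates (ss : list (nat -> nat)) :
  exists N0, forall N, (N0 <= N)%nat -> forall s s', In s ss -> In s' ss ->
    prefix s N = prefix s' N -> s = s'.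
Proof.
  destruct (eventually_all (list_prod ss ss)
    (fun p N => prefix (fst p) N = prefix (snd p) N -> fst p = snd p)) as [N0 H].
  - intros [s s'] _. simpl. destruct (classic (s = s')) as [E | E].
    + exists O. intros; exact E.
    + assert (Hi : exists i, s i <> s' i).
      { apply not_all_ex_not. intros H. apply E, functional_extensionality, H. }
      destruct Hi as [i Hi]. exists (S i). intros N HN H. exfalso. apply Hi.
      apply code_list_inj in H. apply (ext_in_map H). apply in_seq. lia.
  - exists N0. intros N HN s s' Hs Hs'. apply (H N HN (s, s')). apply in_prod; assumption.
Qed.

(* The classical independent family: a number codes a length [N] together with a finite set [T]
   of codes of prefixes of length [N], and belongs to the member of index [s] when the prefix
   of [s] is listed in [T]. *)
Definition indep (s : nat -> nat) (i : nat) : Prop :=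
  exists N T, i = to_nat (N, code_list T) /\ In (prefix s N) T.

(** Choose a length [N >= i0] at which prefixes separate [ss], and list in [T] the prefixes of those
    members of [ss] that satisfy [sigma]; the code of [N] and [T] is the required index. *)
Lemma indep_independent (ss : list (nat -> nat)) (sigma : (nat -> nat) -> Prop) (i0 : nat) :
  exists i, (i0 <= i)%nat /\ forall s, In s ss -> (indep s i <-> sigma s).
Proof.
  destruct (prefix_separates ss) as [N0 HN0].
  set (N := Nat.max N0 i0).
  set (b := fun s => if excluded_middle_informative (sigma s) then true else false).
  assert (Hb : forall s, b s = true <-> sigma s).
  { intros s. unfold b. destruct (excluded_middle_informative (sigma s)); split;
      auto; discriminate. }
  set (T := map (fun s => prefix s N) (filter b ss)).
  exists (to_nat (N, code_list T)). split.
  - pose proof (to_nat_non_decreasing N (code_list T)). lia.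
  - intros s Hs. split.
    + intros (N' & T' & E & HT'). apply to_nat_inj in E. injection E as <- E.
      apply code_list_inj in E. subst T'.
      apply in_map_iff in HT'. destruct HT' as (s' & E & Hs').
      apply filter_In in Hs'. destruct Hs' as [Hs' Hbs'].
      rewrite <- (HN0 N ltac:(lia) s' s Hs' Hs E). apply Hb, Hbs'.
    + intros Hsig. exists N, T. split; [reflexivity | ].
      apply (in_map (fun s => prefix s N)), filter_In. split; [exact Hs | apply Hb, Hsig].
Qed.

(** * Free ultrafilters on the natural numbers and limits along them *)

Record free_ultrafilter (u : (nat -> Prop) -> Prop) : Prop := {
  fu_inter : forall A B, u A -> u B -> u (fun i => A i /\ B i);
  fu_sub : forall A B : nat -> Prop, (forall i, A i -> B i) -> u A -> u B;
  fu_ultra : forall A, u A \/ u (fun i => ~ A i);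
  fu_proper : forall A, u A -> exists i, A i;
  fu_free : forall i0, u (fun i => (i0 <= i)%nat)
}.

Lemma fu_all {A : Type} (u : (nat -> Prop) -> Prop) (Q : A -> nat -> Prop) (l : list A) :
  free_ultrafilter u -> (forall a, In a l -> u (Q a)) ->
  u (fun i => forall a, In a l -> Q a i).
Proof.
  intros Hu. induction l as [|a l IH]; intros H.
  - apply (fu_sub u Hu) with (fun i => (0 <= i)%nat); [intros i _ a [] | apply (fu_free u Hu)].
  - apply (fu_sub u Hu) with (fun i => Q a i /\ forall b, In b l -> Q b i).
    + intros i [Ha Hl] b [<- | Hb]; auto.
    + apply (fu_inter u Hu); [apply H; left; reflexivity | apply IH].
      intros b Hb. apply H. right. exact Hb.
Qed.

(** By independence, the prescribed sets and the tails of [nat] have the finite intersection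
    property. The filter [F] that they generate is extended to an ultrafilter. *)
Lemma indep_ultrafilter (sigma : (nat -> nat) -> Prop) :
  exists u, free_ultrafilter u /\ forall s, u (fun i => indep s i <-> sigma s).
Proof.
  set (F := fun A : nat -> Prop => exists ss i0, forall i, (i0 <= i)%nat ->
    (forall s, In s ss -> (indep s i <-> sigma s)) -> A i).
  assert (HF : filter.ProperFilter F).
  { split; [ | split].
    - intros (ss & i0 & H). destruct (indep_independent ss sigma i0) as (i & Hi & Hs).
      exact (H i Hi Hs).
    - exists nil, O. intros i _ _. exact I.
    - intros A B (ss & i0 & H) (ss' & i0' & H'). exists (ss ++ ss'), (Nat.max i0 i0').
      intros i Hi Hs. split.
      + apply H; [lia | ]. intros s Hin. apply Hs, in_or_app. left. exact Hin.
      + apply H'; [lia | ]. intros s Hin. apply Hs, in_or_app. right. exact Hin.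
    - intros A B HAB (ss & i0 & H). exists ss, i0. intros i Hi Hs. apply HAB, H; assumption. }
  destruct (filter.ultraFilterLemma HF) as (u & Hu & HFu).
  pose proof (@filter.ultra_proper _ _ Hu) as Hp.
  pose proof (@filter.filter_filter _ _ Hp) as Hfil.
  exists u. split; [constructor | ].
  - intros A B. apply filter.filterI.
  - intros A B H. apply filter.filterS. exact H.
  - intros A. apply filter.in_ultra_setVsetC. exact Hu.
  - intros A HA. apply NNPP. intros Hn. apply (filter.filter_not_empty u).
    apply (@filter.filterS _ _ _ A); [ | exact HA]. intros i Hi. apply Hn. exists i. exact Hi.
  - intros i0. apply HFu. exists nil, i0. auto.
  - intros s. apply HFu. exists (s :: nil), O. intros i _ H. apply H. left. reflexivity.
Qed.

(** The limit is the supremum of the levels [t] such that [t <= f i] holds on a member of [u]; for a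
    level above it, the complementary set belongs to [u]. *)
Lemma ultralimit_R (u : (nat -> Prop) -> Prop) (f : nat -> R) :
  free_ultrafilter u -> (forall i, Rabs (f i) <= 1) ->
  exists L, forall eps, 0 < eps -> u (fun i => Rabs (f i - L) < eps).
Proof.
  intros Hu Hf.
  destruct (completeness (fun t => u (fun i => t <= f i))) as [L [Hub Hlub]].
  - exists 1. intros t Ht. destruct (fu_proper u Hu _ Ht) as [i Hi].
    pose proof (Rle_abs (f i)). specialize (Hf i). lra.
  - exists (-1). apply (fu_sub u Hu) with (fun i => (0 <= i)%nat); [ | apply (fu_free u Hu)].
    intros i _. pose proof (Rle_abs (- f i)) as H. rewrite Rabs_Ropp in H. specialize (Hf i). lra.
  - exists L. intros eps He.
    apply (fu_sub u Hu) with (fun i => L - eps / 2 <= f i /\ ~ (L + eps / 2 <= f i)).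
    { intros i [H1 H2]. apply Rabs_def1; lra. }
    apply (fu_inter u Hu).
    + apply NNPP. intros Hn. assert (H : L <= L - eps / 2); [ | lra].
      apply Hlub. intros t Ht. apply Rnot_lt_le. intros Hlt. apply Hn.
      apply (fu_sub u Hu) with (2 := Ht). intros i Hi. lra.
    + destruct (fu_ultra u Hu (fun i => L + eps / 2 <= f i)) as [H | H]; [ | exact H].
      apply Hub in H. lra.
Qed.

Lemma ultralimit_C (u : (nat -> Prop) -> Prop) (z : nat -> C) :
  free_ultrafilter u -> (forall i, Cmod (z i) <= 1) ->
  exists L, forall eps, 0 < eps -> u (fun i => Cmod (z i - L) < eps).
Proof.
  intros Hu Hz.
  destruct (ultralimit_R u (fun i => fst (z i)) Hu) as [a Ha].
  { intros i. eapply Rle_trans; [ | apply Hz].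
    eapply Rle_trans; [apply Rmax_l | apply Rmax_Cmod]. }
  destruct (ultralimit_R u (fun i => snd (z i)) Hu) as [b Hb].
  { intros i. eapply Rle_trans; [ | apply Hz].
    eapply Rle_trans; [apply Rmax_r | apply Rmax_Cmod]. }
  exists (a, b). intros eps He.
  apply (fu_sub u Hu) with (fun i => Rabs (fst (z i) - a) < eps / 2 /\
                                    Rabs (snd (z i) - b) < eps / 2).
  - intros i [H1 H2]. eapply Rle_lt_trans; [apply Cmod_2Rmax | ]. simpl.
    apply Rlt_le_trans with (2 * (eps / 2)); [ | lra].
    assert (Hs : 0 <= sqrt 2 <= 2).
    { split; [apply sqrt_pos | ]. replace 2 with (sqrt (2 * 2)) at 2.
      - apply sqrt_le_1; lra.
      - apply sqrt_square; lra. }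
    assert (Hm : 0 <= Rmax (Rabs (fst (z i) + - a)) (Rabs (snd (z i) + - b)) < eps / 2).
    { split; [eapply Rle_trans; [apply Rabs_pos | apply Rmax_l] | ].
      apply Rmax_lub_lt; assumption. }
    nra.
  - apply (fu_inter u Hu); [apply Ha | apply Hb]; lra.
Qed.

(** A cluster point of the sequence [chi (d i)] rather than a limit: each neighbourhood is visited
    at arbitrarily late indices. *)
Definition limit_along (d : nat -> Z) (x : cfun) : Prop :=
  forall ths eps i0, 0 < eps -> exists i, (i0 <= i)%nat /\
    forall th, In th ths -> Cmod (chi (d i) th - x th) < eps.

Definition fpow (x : cfun) (n : nat) : cfun := fun th => Cpow (x th) n.

(* Cantor's diagonal argument in the set of limits of [chi] along [d]: the coordinate [th j] is
   such that [chi (d i) (th j)] tends to [1] on the independent set of index [code j] and to a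
   root of order [n j + 1] of [-1] off it, and the limit is chosen so as to violate the
   [j]-th equation at [th j]. *)
Lemma limit_avoiding {J : Type} (code : J -> nat -> nat) (n : J -> nat) (m : J -> Z)
  (h : J -> cfun) (d : nat -> Z) :
  (forall j j', code j = code j' -> j = j') -> sparse d ->
  exists x, limit_along d x /\ forall j, fmul (fpow x (S (n j))) (h j) <> chi (m j).
Proof.
  intros Hcode Hd.
  set (v := fun j => PI / INR (S (n j))).
  set (f := fun j i => if excluded_middle_informative (indep (code j) i) then 0 else v j).
  assert (Hth : forall j, exists th, forall i, exists k,
    Rabs (IZR (d i) * th - (f j i + 2 * PI * IZR k)) <= 4 * PI / INR (i + 2))
    by (intros j; apply sparse_interpolation, Hd).
  pose (th := fun j => proj1_sig (constructive_indefinite_description _ (Hth j))).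
  assert (Hthj : forall j i, Cmod (chi (d i) (th j) - expi (f j i)) <= 4 * PI / INR (i + 2)).
  { intros j i. destruct (proj2_sig (constructive_indefinite_description _ (Hth j)) i) as [k Hk].
    fold (th j) in Hk.
    replace (expi (f j i)) with (expi (f j i + 2 * PI * IZR k))
      by (unfold expi; rewrite cos_period_Z, sin_period_Z; reflexivity).
    eapply Rle_trans; [apply expi_lipschitz | exact Hk]. }
  clearbody th. clear Hth.
  (* [sigma] holds at [code j] exactly when the value 1 at [th j] already violates equation [j];
     otherwise the root of -1 is to be used. *)
  set (sigma := fun s => exists j, s = code j /\ h j (th j) <> chi (m j) (th j)).
  destruct (indep_ultrafilter sigma) as (u & Hu & Hsig).
  assert (Hx : forall t, exists L, forall eps, 0 < eps ->
    u (fun i => Cmod (chi (d i) t - L) < eps)).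
  { intros t. apply ultralimit_C; [exact Hu | ]. intros i. right. apply Cmod_expi. }
  pose (x := fun t => proj1_sig (constructive_indefinite_description _ (Hx t))).
  assert (Hxt : forall t eps, 0 < eps -> u (fun i => Cmod (chi (d i) t - x t) < eps))
    by (intros t; exact (proj2_sig (constructive_indefinite_description _ (Hx t)))).
  clearbody x. clear Hx.
  (* If the two sides were at distance [r > 0], some late [i] would bring [chi (d i) (th j)] within
     [r / 2] of both, strictly so for [x (th j)]; an index above [8 * PI / r] makes the
     interpolation error small enough. *)
  assert (Hxj : forall j a, (forall i, (indep (code j) i <-> sigma (code j)) -> f j i = a) ->
    x (th j) = expi a).
  { intros j a Ha. apply NNPP. intros Hne. apply Cmod_minus_pos in Hne.
    set (r := Cmod (x (th j) - expi a)) in *.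
    destruct (archimed (8 * PI / r)) as [Hup _].
    pose proof PI_RGT_0 as Hpi.
    assert (Hpos : 0 < 8 * PI / r) by (apply Rdiv_lt_0_compat; lra).
    destruct (fu_proper u Hu _ (fu_inter u Hu _ _ (Hsig (code j))
      (fu_inter u Hu _ _ (fu_free u Hu (Z.to_nat (up (8 * PI / r))))
        (Hxt (th j) (r / 2) ltac:(lra))))) as (i & H1 & H2 & H3).
    specialize (Hthj j i). rewrite (Ha i H1) in Hthj.
    assert (H4 : 4 * PI / INR (i + 2) <= r / 2).
    { assert (HI : 8 * PI / r <= INR (i + 2)).
      { rewrite INR_IZR_INZ. left. eapply Rlt_le_trans; [exact Hup | ]. apply IZR_le. lia. }
      assert (H8 : 8 * PI <= INR (i + 2) * r).
      { replace (8 * PI) with (8 * PI / r * r) by (field; lra). apply Rmult_le_compat_r; lra. }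
      apply Rmult_le_reg_r with (INR (i + 2)); [lra | ].
      unfold Rdiv at 1. rewrite Rmult_assoc, Rinv_l by lra. lra. }
    pose proof (Cmod_minus_triangle (x (th j)) (chi (d i) (th j)) (expi a)) as H5.
    rewrite (Cmod_minus_sym (x (th j)) (chi (d i) (th j))) in H5. fold r in H5. lra. }
  exists x. split.
  - intros ths eps i0 He.
    destruct (fu_proper u Hu _ (fu_inter u Hu _ _ (fu_free u Hu i0)
      (fu_all u (fun t i => Cmod (chi (d i) t - x t) < eps) ths Hu
        (fun t _ => Hxt t eps He)))) as (i & H1 & H2).
    exists i. split; assumption.
  - intros j Heq. apply (f_equal (fun g => g (th j))) in Heq. unfold fmul, fpow in Heq.
    destruct (classic (h j (th j) = chi (m j) (th j))) as [E | E].
    (* The power of [x (th j)] is -1 here, so the equation would say that [chi (m j) (th j)] equals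
       its own negative, hence vanishes. *)
    + assert (Hns : ~ sigma (code j)).
      { intros (j' & Hj & Hne). apply Hcode in Hj. subst j'. contradiction. }
      rewrite (Hxj j (v j)) in Heq.
      * rewrite expi_pow in Heq. unfold v in Heq.
        replace (INR (S (n j)) * (PI / INR (S (n j)))) with PI in Heq
          by (field; apply not_0_INR; discriminate).
        rewrite expi_PI, E in Heq. apply (expi_neq_0 (IZR (m j) * th j)).
        fold (chi (m j) (th j)). destruct (chi (m j) (th j)) as [a b].
        injection Heq as Ha Hb. simpl in Ha, Hb. apply injective_projections; simpl; lra.
      * intros i Hi. unfold f. destruct (excluded_middle_informative (indep (code j) i)); tauto.
    + assert (Hs : sigma (code j)) by (exists j; split; [reflexivity | exact E]).
      rewrite (Hxj j 0) in Heq.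
      * rewrite expi_pow, Rmult_0_r in Heq. apply E. rewrite <- Heq. unfold expi.
        rewrite cos_0, sin_0. change (1, 0) with (RtoC 1). ring.
      * intros i Hi. unfold f. destruct (excluded_middle_informative (indep (code j) i)); tauto.
Qed.

(** * The semigroup of accumulation points *)

Definition fprod (l : list cfun) : cfun := fold_right fmul (chi 0) l.

Lemma fprod_app (l l' : list cfun) : fprod (l ++ l') = fmul (fprod l) (fprod l').
Proof.
  induction l as [|g l IH]; simpl.
  - symmetry. apply fmul_chi_0.
  - rewrite IH. apply fmul_assoc.
Qed.

Lemma fpow_0 (x : cfun) : fpow x 0 = chi 0.
Proof.
  apply functional_extensionality. intros th. unfold fpow, chi, expi. simpl.
  rewrite Rmult_0_l, cos_0, sin_0. reflexivity.
Qed.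

Lemma limit_along_in_closure (d : nat -> Z) (x : cfun) : limit_along d x -> in_closure x.
Proof.
  intros H ths eps He. destruct (H ths eps O He) as (i & _ & Hi). exists (d i). exact Hi.
Qed.

(** A partial choice of cluster points, given by its graph so that Zorn's lemma applies to
    inclusion. The empty product [chi 0] has to be excepted in the last clause. *)
Definition positive_family (X : (nat -> Z) * cfun -> Prop) : Prop :=
  (forall d x, X (d, x) -> limit_along d x) /\
  (forall d x x', X (d, x) -> X (d, x') -> x = x') /\
  (forall l m, l <> nil -> (forall p, In p l -> X p) -> fprod (map snd l) <> chi m).

(** The chosen points occurring in an equation are named by their sequences: there are only as many
    of these as functions [nat -> nat], whereas [cfun] is larger. Coding proceeds value by value in
    [N]. *)
Definition code_equation (j : nat * Z * list (nat -> Z)) (N : nat) : nat :=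
  let '(n, m, l) := j in
  code_list (n :: code_Z m :: map (fun d => code_Z (d N)) l).

Lemma code_equation_inj (j j' : nat * Z * list (nat -> Z)) :
  code_equation j = code_equation j' -> j = j'.
Proof.
  destruct j as [[n m] l], j' as [[n' m'] l']. intros H.
  assert (HN : forall N, n = n' /\ m = m' /\
    map (fun d => code_Z (d N)) l = map (fun d => code_Z (d N)) l').
  { intros N. apply (f_equal (fun s => s N)) in H. apply code_list_inj in H.
    injection H as Hn Hm Hl. split; [exact Hn | ]. split; [ | exact Hl].
    apply code_Z_inj. exact Hm. }
  destruct (HN O) as (-> & -> & _). f_equal.
  assert (Hl : forall N, map (fun d => code_Z (d N)) l = map (fun d => code_Z (d N)) l')
    by (intros N; apply HN).
  clear H HN. revert l' Hl. induction l as [|d l IH]; intros [|d' l'] Hl.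
  - reflexivity.
  - discriminate (Hl O).
  - discriminate (Hl O).
  - f_equal.
    + apply functional_extensionality. intros N. specialize (Hl N). injection Hl as Hd _.
      apply code_Z_inj. exact Hd.
    + apply IH. intros N. specialize (Hl N). injection Hl as _ Hl. exact Hl.
Qed.

(** By commutativity all occurrences of the new point [x] are collected into one power. *)
Lemma fprod_extension (X : (nat -> Z) * cfun -> Prop) (d : nat -> Z) (x : cfun)
  (l : list ((nat -> Z) * cfun)) :
  (forall p, In p l -> X p \/ p = (d, x)) ->
  exists k l0, (forall p, In p l0 -> X p) /\
    fprod (map snd l) = fmul (fpow x k) (fprod (map snd l0)) /\
    (l <> nil -> k <> O \/ l0 <> nil).
Proof.
  induction l as [|p l IH]; intros H.
  - exists O, nil. split; [intros p [] | ]. split; [ | congruence].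
    rewrite fpow_0, fmul_chi_0. reflexivity.
  - destruct IH as (k & l0 & Hl0 & E & _); [intros q Hq; apply H; right; exact Hq | ].
    destruct (H p (or_introl eq_refl)) as [Hp | ->].
    + exists k, (p :: l0). split; [intros q [<- | Hq]; auto | ].
      split; [ | right; discriminate]. simpl. rewrite E, !fmul_assoc.
      f_equal. apply fmul_comm.
    + exists (S k), l0. split; [exact Hl0 | ]. split; [ | left; discriminate].
      simpl. rewrite E, fmul_assoc. reflexivity.
Qed.

Lemma positive_family_extension (X : (nat -> Z) * cfun -> Prop) (d : nat -> Z) :
  positive_family X -> sparse d -> (forall x, ~ X (d, x)) ->
  exists x, positive_family (fun p => X p \/ p = (d, x)).
Proof.
  intros (Hlim & Hfun & Hpos) Hd HX.
  (* The equations range over all lists of sequences, so sequences outside the domain of [X] receive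
     an arbitrary value; this only adds equations to be avoided. *)
  set (val := fun e => epsilon (inhabits (chi 0)) (fun x => X (e, x))).
  assert (Hval : forall e x, X (e, x) -> val e = x).
  { intros e x Hx. apply (Hfun e); [ | exact Hx].
    apply (epsilon_spec (inhabits (chi 0)) (fun y => X (e, y))). exists x. exact Hx. }
  destruct (limit_avoiding code_equation (fun j => fst (fst j)) (fun j => snd (fst j))
    (fun j => fprod (map val (snd j))) d code_equation_inj Hd) as (x & Hx & Hav).
  exists x. split; [ | split].
  - intros e y [Hy | E]; [apply Hlim; exact Hy | ]. injection E as -> ->. exact Hx.
  - intros e y y' [Hy | E] [Hy' | E'].
    + apply (Hfun e); assumption.
    + injection E' as -> ->. destruct (HX _ Hy).
    + injection E as -> ->. destruct (HX _ Hy').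
    + congruence.
  - intros l m Hl Hin. destruct (fprod_extension X d x l Hin) as (k & l0 & Hl0 & -> & Hk).
    (* Without the new point, this is a non-empty product of old points; with it, the exponent is
       positive and the triple [(k, m, map fst l0)] indexes one of the avoided equations. *)
    destruct k as [|k].
    + rewrite fpow_0, fmul_chi_0. apply Hpos; [ | exact Hl0].
      destruct (Hk Hl) as [[] | H]; [reflexivity | exact H].
    + specialize (Hav (k, m, map fst l0)). simpl in Hav. rewrite map_map in Hav.
      rewrite (map_ext_in (fun p => val (fst p)) snd) in Hav; [exact Hav | ].
      intros [e y] Hp. apply Hval, Hl0, Hp.
Qed.

(** The list is required to be non-empty because the chain may be empty. *)
Lemma chain_list {T : Type} (F : (T -> Prop) -> Prop) (l : list T) :
  (forall Y Y', F Y -> F Y' -> (forall p, Y p -> Y' p) \/ (forall p, Y' p -> Y p)) ->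
  l <> nil -> (forall p, In p l -> exists Y, F Y /\ Y p) ->
  exists Y, F Y /\ forall p, In p l -> Y p.
Proof.
  intros HF. induction l as [|p l IH]; intros Hl H; [congruence | ].
  destruct (H p (or_introl eq_refl)) as (Y & HY & Hp).
  destruct l as [|q l].
  - exists Y. split; [exact HY | ]. intros r [<- | []]. exact Hp.
  - destruct IH as (Y' & HY' & Hl'); [discriminate | intros r Hr; apply H; right; exact Hr | ].
    destruct (HF Y Y' HY HY') as [HYY | HYY].
    + exists Y'. split; [exact HY' | ]. intros r [<- | Hr]; auto.
    + exists Y. split; [exact HY | ]. intros r [<- | Hr]; auto.
Qed.

(** Each clause of [positive_family] concerns finitely many pairs at a time, so it passes to unions
    of chains; a maximal family is total by [positive_family_extension]. *)
Lemma maximal_positive_family :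
  exists X, positive_family X /\ forall d, sparse d -> exists x, X (d, x).
Proof.
  destruct (@classical_sets.Zorn_bigcup ((nat -> Z) * cfun)%type positive_family)
    as (X & HX & Hmax).
  - intros F HF Hchain.
    assert (HC : forall l, l <> nil ->
        (forall p, In p l -> classical_sets.bigcup F (fun Y => Y) p) ->
      exists Y, F Y /\ forall p, In p l -> Y p).
    { intros l Hl H. apply chain_list; [exact Hchain | exact Hl | ].
      intros p Hp. destruct (H p Hp) as [Y HY HYp]. exists Y. split; assumption. }
    split; [ | split].
    + intros d x [Y HY Hx]. destruct (HF Y HY) as [H _]. apply H, Hx.
    + intros d x x' Hx Hx'.
      destruct (HC ((d, x) :: (d, x') :: nil)) as (Y & HY & H);
        [discriminate | intros p [<- | [<- | []]]; assumption | ].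
      destruct (HF Y HY) as (_ & Hf & _).
      apply (Hf d); apply H; simpl; auto.
    + intros l m Hl Hin. destruct (HC l Hl Hin) as (Y & HY & H).
      destruct (HF Y HY) as (_ & _ & Hp). apply Hp; assumption.
  - exists X. split; [exact HX | ]. intros d Hd. apply NNPP. intros Hn.
    assert (Hn' : forall x, ~ X (d, x)) by (intros x Hx; apply Hn; exists x; exact Hx).
    destruct (positive_family_extension X d HX Hd Hn') as [x Hx].
    apply (Hmax _) with (2 := Hx). split.
    + intros p Hp. left. exact Hp.
    + intros H. apply (Hn' x), H. right. reflexivity.
Qed.

(** [P] consists of the translates by characters of non-empty products of chosen points. Characters
    being invertible, a translate in [chi Z] would put the product itself there. *)
Lemma positive_semigroup :
  exists P : cfun -> Prop,
    (forall g h, P g -> P h -> P (fmul g h)) /\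
    (forall m g, P g -> P (fmul (chi m) g)) /\
    (forall m, ~ P (chi m)) /\
    (forall g, P g -> in_closure g) /\
    (forall d, sparse d -> exists x, P x /\ limit_along d x).
Proof.
  destruct maximal_positive_family as (X & (Hlim & _ & Hpos) & Htot).
  exists (fun g => exists l m, l <> nil /\ (forall p, In p l -> X p) /\
    g = fmul (chi m) (fprod (map snd l))).
  split; [ | split; [ | split; [ | split]]].
  - intros g h (l & m & Hl & HlX & ->) (l' & m' & Hl' & HlX' & ->).
    exists (l ++ l'), (m + m')%Z. split; [ | split].
    + intros H. apply app_eq_nil in H. tauto.
    + intros p Hp. apply in_app_or in Hp. destruct Hp; auto.
    + rewrite map_app, fprod_app, chi_add.
      apply functional_extensionality. intros th. unfold fmul. ring.
  - intros m g (l & m' & Hl & HlX & ->). exists l, (m + m')%Z.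
    rewrite chi_add, fmul_assoc. auto.
  - intros m (l & m' & Hl & HlX & E). symmetry in E. apply fmul_chi_cancel in E.
    rewrite <- chi_add in E. exact (Hpos l _ Hl HlX E).
  - intros g (l & m & _ & HlX & ->). apply in_closure_mul; [apply in_closure_chi | ].
    induction l as [|[d x] l IH]; [apply in_closure_chi | ].
    apply in_closure_mul; [ | apply IH; intros p Hp; apply HlX; right; exact Hp].
    apply (limit_along_in_closure d), Hlim, HlX. left. reflexivity.
  - intros d Hd. destruct (Htot d Hd) as [x Hx]. exists x. split; [ | apply (Hlim d), Hx].
    exists ((d, x) :: nil), 0%Z. split; [discriminate | ]. split.
    + intros p [<- | []]. exact Hx.
    + simpl. rewrite fmul_chi_0, fmul_comm, fmul_chi_0. reflexivity.
Qed.

(** * The extension of the bicyclic semigroup *)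

Definition bideg (c : bicyclic) : Z := (Z.of_nat (fst c) - Z.of_nat (snd c))%Z.

Lemma bideg_mul (c c' : bicyclic) : bideg (bicyclic_mul c c') = (bideg c + bideg c')%Z.
Proof. destruct c, c'. unfold bideg; simpl. lia. Qed.

Lemma bicyclic_mul_assoc (x y z : bicyclic) :
  bicyclic_mul x (bicyclic_mul y z) = bicyclic_mul (bicyclic_mul x y) z.
Proof. destruct x, y, z. simpl. f_equal; lia. Qed.

Lemma bideg_surj (m : Z) : exists c, bideg c = m.
Proof. exists (Z.to_nat m, Z.to_nat (- m)). unfold bideg; simpl. lia. Qed.

Definition admissible (P : cfun -> Prop) : Prop :=
  (forall g h, P g -> P h -> P (fmul g h)) /\
  (forall m g, P g -> P (fmul (chi m) g)) /\
  (forall m, ~ P (chi m)).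

Definition limit_part (P : cfun -> Prop) : Type := {g : cfun | P g \/ exists m, g = chi m}.
Definition extension (P : cfun -> Prop) : Type := (bicyclic + limit_part P)%type.

Definition proj {P : cfun -> Prop} (s : extension P) : cfun :=
  match s with inl c => chi (bideg c) | inr g => proj1_sig g end.

Lemma proj_spec {P : cfun -> Prop} (s : extension P) :
  P (proj s) \/ exists m, proj s = chi m.
Proof.
  destruct s as [c | g]; [right; exists (bideg c); reflexivity | exact (proj2_sig g)].
Qed.

Lemma proj_mul_spec {P : cfun -> Prop} (HP : admissible P) (s t : extension P) :
  P (fmul (proj s) (proj t)) \/ exists m, fmul (proj s) (proj t) = chi m.
Proof.
  destruct HP as (H1 & H2 & _).
  destruct (proj_spec s) as [Hs | [m Hs]], (proj_spec t) as [Ht | [n Ht]].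
  - left. auto.
  - left. rewrite Ht, fmul_comm. auto.
  - left. rewrite Hs. auto.
  - right. exists (m + n)%Z. rewrite Hs, Ht, chi_add. reflexivity.
Qed.

Definition ext_mul {P : cfun -> Prop} (HP : admissible P) (s t : extension P) : extension P :=
  match s, t with
  | inl c, inl c' => inl (bicyclic_mul c c')
  | _, _ => inr (exist _ (fmul (proj s) (proj t)) (proj_mul_spec HP s t))
  end.

Lemma proj_mul {P : cfun -> Prop} (HP : admissible P) (s t : extension P) :
  proj (ext_mul HP s t) = fmul (proj s) (proj t).
Proof.
  destruct s as [c | g], t as [c' | g']; try reflexivity.
  simpl. rewrite bideg_mul. apply chi_add.
Qed.

Lemma inr_eq {P : cfun -> Prop} (g h : limit_part P) :
  proj1_sig g = proj1_sig h -> (inr g : extension P) = inr h.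
Proof.
  destruct g as [g Hg], h as [h Hh]. simpl. intros <-.
  rewrite (proof_irrelevance _ Hg Hh). reflexivity.
Qed.

(** As soon as one factor is in [limit_part P], both sides are, and there elements are determined by
    their projections. *)
Lemma ext_mul_assoc {P : cfun -> Prop} (HP : admissible P) (x y z : extension P) :
  ext_mul HP x (ext_mul HP y z) = ext_mul HP (ext_mul HP x y) z.
Proof.
  assert (H : proj (ext_mul HP x (ext_mul HP y z)) = proj (ext_mul HP (ext_mul HP x y) z))
    by (rewrite !proj_mul; apply fmul_assoc).
  destruct x as [a | g], y as [b | h], z as [c | k]; try (apply inr_eq; exact H).
  simpl. rewrite bicyclic_mul_assoc. reflexivity.
Qed.

(** [P] is an ideal in the union of [P] and [chi Z], and it misses [chi Z]; a product can therefore
    be a character only if both factors are. *)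
Lemma proj_mul_chi {P : cfun -> Prop} (HP : admissible P) (s t : extension P) (k : Z) :
  proj (ext_mul HP s t) = chi k -> exists i j, proj s = chi i /\ proj t = chi j.
Proof.
  rewrite proj_mul. destruct HP as (H1 & H2 & H3). intros H.
  destruct (proj_spec s) as [Hs | [i Hs]], (proj_spec t) as [Ht | [j Ht]].
  - destruct (H3 k). rewrite <- H. auto.
  - destruct (H3 k). rewrite <- H, Ht, fmul_comm. auto.
  - destruct (H3 k). rewrite <- H, Hs. auto.
  - exists i, j. auto.
Qed.

(** * The topology of the extension *)

Definition indicator {X : Type} (Q : X -> Prop) (x : X) : R :=
  if excluded_middle_informative (Q x) then 1 else 0.

Lemma indicator_iff {X : Type} (Q : X -> Prop) (x y : X) :
  (Q x <-> Q y) -> indicator Q x = indicator Q y.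
Proof.
  unfold indicator. destruct (excluded_middle_informative (Q x)),
    (excluded_middle_informative (Q y)); tauto.
Qed.

Lemma indicator_near {X : Type} (Q : X -> Prop) (x y : X) :
  Rabs (indicator Q y - indicator Q x) < 1 -> (Q y <-> Q x).
Proof.
  unfold indicator. destruct (excluded_middle_informative (Q x)),
    (excluded_middle_informative (Q y)); intros H; try tauto; exfalso; revert H;
    unfold Rabs; destruct (Rcase_abs _); lra.
Qed.

Lemma Rabs_diff_lt {a b eps : R} : a = b -> 0 < eps -> Rabs (a - b) < eps.
Proof. intros -> He. rewrite Rminus_diag, Rabs_R0. exact He. Qed.

(** Distances to constants induce the pointwise topology by real-valued functions. The point
    indicators isolate [C(p,q)], and the fibre indicators make each fibre of [proj] over a character
    clopen. *)
Inductive test {P : cfun -> Prop} : (extension P -> R) -> Prop :=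
| test_dist (th : R) (z : C) : test (fun s => Cmod (proj s th - z))
| test_point (c : bicyclic) : test (indicator (fun s => s = inl c))
| test_fiber (k : Z) : test (indicator (fun s => proj s = chi k)).

Lemma test_separates (P : cfun -> Prop) : separates (@test P).
Proof.
  assert (Hl : forall c (y : extension P), inl c <> y ->
    indicator (fun s : extension P => s = inl c) (inl c) <>
    indicator (fun s : extension P => s = inl c) y).
  { intros c y Hne E. apply Hne. symmetry.
    apply (indicator_near (fun s : extension P => s = inl c) (inl c) y); [ | reflexivity].
    apply Rabs_diff_lt; [symmetry; exact E | lra]. }
  intros [c | g] y Hne.
  - exists (indicator (fun s => s = inl c)). split; [apply test_point | apply Hl, Hne].
  - destruct y as [c | h].
    + exists (indicator (fun s => s = inl c)). split; [apply test_point | ].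
      apply not_eq_sym, Hl, not_eq_sym, Hne.
    + destruct (cfun_neq (proj1_sig g) (proj1_sig h)) as [th Hth].
      { intros E. apply Hne, inr_eq, E. }
      exists (fun s => Cmod (proj s th - proj1_sig h th)). split; [apply test_dist | ].
      simpl. replace (proj1_sig h th - proj1_sig h th)%C with (RtoC 0) by ring.
      rewrite Cmod_0. apply Cmod_minus_pos in Hth. lra.
Qed.

Lemma nbhd_indicator {P : cfun -> Prop} (Q : extension P -> Prop) (s : extension P) :
  test (indicator Q) -> nbhd test s (fun s' => Q s' <-> Q s).
Proof.
  intros HQ. apply nbhd_sub with (1 := nbhd_fun test s (indicator Q) 1 HQ ltac:(lra)).
  intros s'. apply indicator_near.
Qed.

Lemma nbhd_proj {P : cfun -> Prop} (s : extension P) (th eps : R) :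
  0 < eps -> nbhd test s (fun s' => Cmod (proj s' th - proj s th) < eps).
Proof.
  intros He.
  apply nbhd_sub with (1 := nbhd_fun test s _ eps (test_dist th (proj s th)) He).
  intros s'. simpl.
  replace (proj s th - proj s th)%C with (RtoC 0) by ring. rewrite Cmod_0, Rminus_0_r.
  rewrite Rabs_right by (apply Rle_ge, Cmod_ge_0). auto.
Qed.

(** * Joint continuity of the multiplication *)

Definition nbhd2 {P : cfun -> Prop} (s t : extension P)
  (W : extension P -> extension P -> Prop) : Prop :=
  exists U V, nbhd test s U /\ nbhd test t V /\ forall s' t', U s' -> V t' -> W s' t'.

Lemma nbhd2_mul_dist {P : cfun -> Prop} (HP : admissible P) (s t : extension P) (th eps : R) :
  0 < eps -> nbhd2 s t (fun s' t' =>
    Cmod (proj (ext_mul HP s' t') th - proj (ext_mul HP s t) th) < eps).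
Proof.
  intros He. destruct (Cmult_continuous (proj s th) (proj t th) eps He) as (d & Hd & H).
  exists (fun s' => Cmod (proj s' th - proj s th) < d),
    (fun t' => Cmod (proj t' th - proj t th) < d).
  split; [apply nbhd_proj, Hd | ]. split; [apply nbhd_proj, Hd | ].
  intros s' t' Hs Ht. rewrite !proj_mul. apply H; assumption.
Qed.

(** If the product lies over [chi k], both factors lie in open fibres, whose product is a single
    character. If not, it differs from [chi k] at some angle, and continuity at that angle preserves
    the difference. *)
Lemma nbhd2_mul_fiber {P : cfun -> Prop} (HP : admissible P) (s t : extension P) (k : Z) :
  nbhd2 s t (fun s' t' =>
    proj (ext_mul HP s' t') = chi k <-> proj (ext_mul HP s t) = chi k).
Proof.
  destruct (classic (proj (ext_mul HP s t) = chi k)) as [E | E].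
  - destruct (proj_mul_chi HP s t k E) as (i & j & Hs & Ht).
    exists (fun s' => proj s' = chi i <-> proj s = chi i),
      (fun t' => proj t' = chi j <-> proj t = chi j).
    split; [apply (nbhd_indicator (fun s' => proj s' = chi i)), test_fiber | ].
    split; [apply (nbhd_indicator (fun t' => proj t' = chi j)), test_fiber | ].
    intros s' t' Hs' Ht'. rewrite proj_mul in E |- *. rewrite proj_mul.
    rewrite (proj2 Hs' Hs), (proj2 Ht' Ht), Hs, Ht. tauto.
  - destruct (cfun_neq _ _ E) as [th Hth]. apply Cmod_minus_pos in Hth.
    destruct (nbhd2_mul_dist HP s t th _ Hth) as (U & V & HU & HV & H).
    exists U, V. split; [exact HU | ]. split; [exact HV | ].
    intros s' t' Hs Ht. split; [ | tauto]. intros E'. exfalso.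
    specialize (H s' t' Hs Ht). rewrite E', Cmod_minus_sym in H. lra.
Qed.

Lemma nbhd_avoid {P : cfun -> Prop} (g : limit_part P) (cs : list bicyclic) :
  nbhd test (inr g : extension P) (fun s => forall c, In c cs -> s <> inl c).
Proof.
  apply (nbhd_all test (inr g) (fun c s => s <> inl c)). intros c _.
  apply nbhd_sub with (fun s => s = inl c <-> (inr g : extension P) = inl c).
  - apply (nbhd_indicator (fun s => s = inl c)), test_point.
  - intros s Hs E. apply Hs in E. discriminate.
Qed.

(* In [p^a q^b . p^c q^d] the exponent of [p] is at least [a] and that of [q] at least [d]. *)
Lemma nbhd2_mul_point {P : cfun -> Prop} (HP : admissible P) (s t : extension P)
  (c : bicyclic) :
  nbhd2 s t (fun s' t' => ext_mul HP s' t' = inl c <-> ext_mul HP s t = inl c).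
Proof.
  destruct (classic (proj (ext_mul HP s t) = chi (bideg c))) as [E | E].
  2: { destruct (nbhd2_mul_fiber HP s t (bideg c)) as (U & V & HU & HV & H).
       exists U, V. split; [exact HU | ]. split; [exact HV | ].
       intros s' t' Hs Ht. specialize (H s' t' Hs Ht).
       split; intros Ec; exfalso; apply E; [apply H | ]; rewrite Ec; reflexivity. }
  destruct (proj_mul_chi HP s t _ E) as (i & j & Hs & Ht).
  assert (Hsi : nbhd test s (fun s' => proj s' = chi i)).
  { apply nbhd_sub with (fun s' => proj s' = chi i <-> proj s = chi i); [ | tauto].
    apply (nbhd_indicator (fun s' => proj s' = chi i)), test_fiber. }
  assert (Htj : nbhd test t (fun t' => proj t' = chi j)).
  { apply nbhd_sub with (fun t' => proj t' = chi j <-> proj t = chi j); [ | tauto].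
    apply (nbhd_indicator (fun t' => proj t' = chi j)), test_fiber. }
  destruct c as [a b]. destruct s as [x | g].
  - destruct t as [y | h].
    + exists (fun s' => s' = inl x <-> (inl x : extension P) = inl x),
        (fun t' => t' = inl y <-> (inl y : extension P) = inl y).
      split; [apply (nbhd_indicator (fun s' => s' = inl x)), test_point | ].
      split; [apply (nbhd_indicator (fun t' => t' = inl y)), test_point | ].
      intros s' t' Hs' Ht'. rewrite (proj2 Hs' eq_refl), (proj2 Ht' eq_refl). tauto.
    (* The excluded list contains every [(a2, b2)] of degree [j] with [b2 <= b]; any other right
       factor in this fibre gives a product whose exponent of [q] exceeds [b]. *)
    + exists (fun _ => True), (fun t' => proj t' = chi j /\ forall c,
        In c (map (fun n => (Z.to_nat (Z.of_nat n + j), n)) (seq 0 (S b))) -> t' <> inl c).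
      split; [apply nbhd_full | ].
      split; [apply nbhd_inter; [exact Htj | apply nbhd_avoid] | ].
      intros s' t' _ [Hj Hav]. split; [ | discriminate]. intros Ec. exfalso.
      destruct s' as [[a1 b1] | g'], t' as [[a2 b2] | h']; try discriminate.
      injection Ec as E1 E2. simpl in Hj. apply chi_inj in Hj.
      unfold bideg in Hj; simpl in Hj.
      apply (Hav (a2, b2)); [ | reflexivity]. apply in_map_iff. exists b2.
      split; [f_equal; lia | apply in_seq; lia].
  (* Symmetrically, the left factors of degree [i] whose exponent of [p] is at most [a] are
     excluded. *)
  - exists (fun s' => proj s' = chi i /\ forall c,
        In c (map (fun n => (n, Z.to_nat (Z.of_nat n - i))) (seq 0 (S a))) -> s' <> inl c),
      (fun _ => True).
    split; [apply nbhd_inter; [exact Hsi | apply nbhd_avoid] | ].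
    split; [apply nbhd_full | ].
    intros s' t' [Hi Hav] _. split; [ | destruct t; discriminate]. intros Ec. exfalso.
    destruct s' as [[a1 b1] | g'], t' as [[a2 b2] | h']; try discriminate.
    injection Ec as E1 E2. simpl in Hi. apply chi_inj in Hi.
    unfold bideg in Hi; simpl in Hi.
    apply (Hav (a1, b1)); [ | reflexivity]. apply in_map_iff. exists a1.
    split; [f_equal; lia | apply in_seq; lia].
Qed.

Lemma ext_mul_continuous {P : cfun -> Prop} (HP : admissible P) :
  jointly_continuous (initial_topology (@test P)) (ext_mul HP).
Proof.
  apply initial_jointly_continuous. intros f Hf s t eps He.
  destruct Hf as [th z | c | k].
  - destruct (nbhd2_mul_dist HP s t th eps He) as (U & V & HU & HV & H).
    exists U, V. split; [exact HU | ]. split; [exact HV | ]. intros s' t' Hs Ht.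
    eapply Rle_lt_trans; [apply Cmod_dist_lipschitz | apply H; assumption].
  - destruct (nbhd2_mul_point HP s t c) as (U & V & HU & HV & H).
    exists U, V. split; [exact HU | ]. split; [exact HV | ]. intros s' t' Hs Ht.
    apply Rabs_diff_lt; [apply indicator_iff, H; assumption | exact He].
  - destruct (nbhd2_mul_fiber HP s t k) as (U & V & HU & HV & H).
    exists U, V. split; [exact HU | ]. split; [exact HV | ]. intros s' t' Hs Ht.
    apply Rabs_diff_lt; [apply indicator_iff, H; assumption | exact He].
Qed.

(** * Density and accumulation points *)

Lemma fiber_converges {P : cfun -> Prop} (g : limit_part P) (k : Z)
  (U : extension P -> Prop) :
  proj1_sig g = chi k -> nbhd test (inr g) U ->
  exists cs, forall c, bideg c = k -> ~ In c cs -> U (inl c).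
Proof.
  intros Hg (l & eps & He & Hl & HU).
  assert (H : exists cs, forall c, bideg c = k -> ~ In c cs -> near l eps (inr g) (inl c)).
  { clear HU. induction l as [|f l IH].
    - exists nil. intros c _ _ f [].
    - destruct IH as [cs Hcs]; [intros f' Hf'; apply Hl; right; exact Hf' | ].
      (* Distances and fibre indicators are constant on the fibre; a point indicator tells at most
         one element from [g]. *)
      assert (Hf : exists cs', forall c, bideg c = k -> ~ In c cs' ->
        Rabs (f (inl c) - f (inr g)) < eps).
      { destruct (Hl f (or_introl eq_refl)) as [th z | c0 | i].
        - exists nil. intros c Hc _. apply Rabs_diff_lt; [ | exact He].
          simpl. rewrite Hg, Hc. reflexivity.
        - exists (c0 :: nil). intros c _ Hc. apply Rabs_diff_lt; [ | exact He].
          apply indicator_iff. split; [ | discriminate].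
          intros E. injection E as ->. destruct Hc. left. reflexivity.
        - exists nil. intros c Hc _. apply Rabs_diff_lt; [ | exact He].
          apply indicator_iff. simpl. rewrite Hg, Hc. tauto. }
      destruct Hf as [cs' Hcs']. exists (cs ++ cs'). intros c Hc Hn f' [<- | Hf'].
      + apply Hcs'; [exact Hc | ]. intros Hin. apply Hn, in_or_app. right. exact Hin.
      + apply Hcs; [exact Hc | | exact Hf'].
        intros Hin. apply Hn, in_or_app. left. exact Hin. }
  destruct H as [cs Hcs]. exists cs. intros c Hc Hn. apply HU, Hcs; assumption.
Qed.

(** Away from [chi Z], a point or fibre indicator in the neighbourhood costs only one forbidden
    degree, collected in [ks]; the distances give the conditions on [ths]. *)
Lemma nbhd_limit {P : cfun -> Prop} (g : limit_part P) (U : extension P -> Prop) :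
  (forall k, proj1_sig g <> chi k) -> nbhd test (inr g) U ->
  exists ths eps ks, 0 < eps /\ forall c, ~ In (bideg c) ks ->
    (forall th, In th ths -> Cmod (chi (bideg c) th - proj1_sig g th) < eps) -> U (inl c).
Proof.
  intros Hg (l & eps & He & Hl & HU).
  assert (H : exists ths delta ks, 0 < delta /\ forall c, ~ In (bideg c) ks ->
    (forall th, In th ths -> Cmod (chi (bideg c) th - proj1_sig g th) < delta) ->
    near l eps (inr g) (inl c)).
  { clear HU. induction l as [|f l IH].
    - exists nil, 1, nil. split; [lra | ]. intros c _ _ f [].
    - destruct IH as (ths & d & ks & Hd & H);
        [intros f' Hf'; apply Hl; right; exact Hf' | ].
      assert (Hf : exists ths' d' ks', 0 < d' /\ forall c, ~ In (bideg c) ks' ->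
        (forall th, In th ths' -> Cmod (chi (bideg c) th - proj1_sig g th) < d') ->
        Rabs (f (inl c) - f (inr g)) < eps).
      { destruct (Hl f (or_introl eq_refl)) as [th z | c0 | i].
        - exists (th :: nil), eps, nil. split; [exact He | ]. intros c _ Hth.
          eapply Rle_lt_trans; [apply Cmod_dist_lipschitz | ].
          apply Hth. left. reflexivity.
        - exists nil, 1, (bideg c0 :: nil). split; [lra | ]. intros c Hc _.
          apply Rabs_diff_lt; [ | exact He]. apply indicator_iff. split; [ | discriminate].
          intros E. injection E as ->. destruct Hc. left. reflexivity.
        - exists nil, 1, (i :: nil). split; [lra | ]. intros c Hc _.
          apply Rabs_diff_lt; [ | exact He]. apply indicator_iff. simpl. split.
          + intros E. apply chi_inj in E. destruct Hc. left. symmetry. exact E.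
          + intros E. destruct (Hg i E). }
      destruct Hf as (ths' & d' & ks' & Hd' & H').
      exists (ths ++ ths'), (Rmin d d'), (ks ++ ks').
      split; [apply Rmin_pos; assumption | ]. intros c Hc Hth f' [<- | Hf'].
      + apply H'; [intros Hin; apply Hc, in_or_app; right; exact Hin | ].
        intros th Hin. eapply Rlt_le_trans; [apply Hth, in_or_app; right; exact Hin | ].
        apply Rmin_r.
      + apply H; [intros Hin; apply Hc, in_or_app; left; exact Hin | | exact Hf'].
        intros th Hin. eapply Rlt_le_trans; [apply Hth, in_or_app; left; exact Hin | ].
        apply Rmin_l. }
  destruct H as (ths & d & ks & Hd & H). exists ths, d, ks. split; [exact Hd | ].
  intros c Hc Hth. apply HU, H; assumption.
Qed.

(** Each forbidden [k] is excluded by adding an angle where [chi k] and [g] differ and making [eps]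
    at most that difference. *)
Lemma in_closure_avoid (g : cfun) (ks : list Z) : in_closure g ->
  (forall k, g <> chi k) -> forall ths eps, 0 < eps ->
  exists m, ~ In m ks /\ forall th, In th ths -> Cmod (chi m th - g th) < eps.
Proof.
  intros Hcl Hg. induction ks as [|k ks IH]; intros ths eps He.
  - destruct (Hcl ths eps He) as [m Hm]. exists m. split; [intros [] | exact Hm].
  - destruct (cfun_neq _ _ (not_eq_sym (Hg k))) as [th0 Hth0]. apply Cmod_minus_pos in Hth0.
    destruct (IH (th0 :: ths) (Rmin eps (Cmod (chi k th0 - g th0)))) as (m & Hm & H);
      [apply Rmin_pos; assumption | ].
    exists m. split.
    + intros [<- | Hin]; [ | exact (Hm Hin)].
      specialize (H th0 (or_introl eq_refl)).
      pose proof (Rmin_r eps (Cmod (chi k th0 - g th0))). lra.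
    + intros th Hth. eapply Rlt_le_trans; [apply H; right; exact Hth | apply Rmin_l].
Qed.

Lemma in_list_max (l : list nat) (n : nat) : In n l -> (n <= list_max l)%nat.
Proof.
  intros H. pose proof (proj1 (list_max_le l (list_max l)) (le_n _)) as HF.
  rewrite Forall_forall in HF. apply HF, H.
Qed.

Lemma fiber_infinite (k : Z) (cs : list bicyclic) : exists c, bideg c = k /\ ~ In c cs.
Proof.
  set (n := S (list_max (map fst cs))).
  exists (Z.to_nat k + n, Z.to_nat (- k) + n)%nat. split; [unfold bideg; simpl; lia | ].
  intros H. apply (in_map fst), in_list_max in H. simpl in H. unfold n in H. lia.
Qed.

Lemma bicyclic_dense (P : cfun -> Prop) : (forall m, ~ P (chi m)) ->
  (forall g, P g -> in_closure g) ->
  dense (initial_topology (@test P)) (fun s => exists c, s = inl c).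
Proof.
  intros HP Hcl U HU [s Hs]. destruct s as [c | g].
  - exists (inl c). split; [exact Hs | exists c; reflexivity].
  - assert (H : exists c, U (inl c)).
    { destruct (proj2_sig g) as [Hg | [k Hk]].
      - assert (Hne : forall k, proj1_sig g <> chi k)
          by (intros k E; apply (HP k); rewrite <- E; exact Hg).
        destruct (nbhd_limit g U Hne (HU _ Hs)) as (ths & eps & ks & He & H).
        destruct (in_closure_avoid _ ks (Hcl _ Hg) Hne ths eps He) as (m & Hm & Hth).
        destruct (bideg_surj m) as [c <-]. exists c. apply H; assumption.
      - destruct (fiber_converges g k U Hk (HU _ Hs)) as [cs Hcs].
        destruct (fiber_infinite k cs) as (c & Hc & Hn). exists c. apply Hcs; assumption. }
    destruct H as [c Hc]. exists (inl c). split; [exact Hc | exists c; reflexivity].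
Qed.

Lemma finite_of_finite_fibers (B : bicyclic -> Prop) (N : Z) :
  (forall k, exists cs, forall c, B c -> bideg c = k -> In c cs) ->
  (forall c, B c -> (Z.abs (bideg c) <= N)%Z) ->
  exists cs, forall c, B c -> In c cs.
Proof.
  intros Hfib HN.
  pose (cs := fun k => proj1_sig (constructive_indefinite_description _ (Hfib k))).
  assert (Hcs : forall k c, B c -> bideg c = k -> In c (cs k))
    by (intros k; exact (proj2_sig (constructive_indefinite_description _ (Hfib k)))).
  exists (flat_map (fun i => cs (Z.of_nat i - N)%Z) (seq 0 (S (Z.to_nat (2 * N))))).
  intros c Hc. specialize (HN c Hc). apply in_flat_map.
  exists (Z.to_nat (bideg c + N)). split; [apply in_seq; lia | ].
  apply Hcs; [exact Hc | lia].
Qed.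

Lemma extension_pracompact (P : cfun -> Prop) : (forall m, ~ P (chi m)) ->
  (forall g, P g -> in_closure g) ->
  (forall d, sparse d -> exists x, P x /\ limit_along d x) ->
  countably_pracompact (initial_topology (@test P)).
Proof.
  intros HP Hcl Hlim. exists (fun s => exists c, s = inl c).
  split; [apply bicyclic_dense; assumption | ].
  intros B HB Hinf.
  destruct (classic (exists k, forall cs, exists c, B (inl c) /\ bideg c = k /\ ~ In c cs))
    as [[k Hk] | Hfib].
  - exists (inr (exist _ (chi k) (or_intror (ex_intro _ k eq_refl)))).
    intros U HU Hx.
    destruct (fiber_converges _ k U (eq_refl : proj1_sig (exist _ _ _) = chi k) (HU _ Hx))
      as [cs Hcs].
    destruct (Hk cs) as (c & Hc & Hck & Hn). exists (inl c).
    split; [exact Hc | ]. split; [apply Hcs; assumption | discriminate].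
  (* Now [B] meets every fibre in a finite set, so bounded degrees would make [B] finite. *)
  - assert (Hub : forall N, exists m, (exists c, B (inl c) /\ bideg c = m) /\ (N < Z.abs m)%Z).
    { intros N. apply NNPP. intros Hn. apply Hinf.
      destruct (finite_of_finite_fibers (fun c => B (inl c)) N) as [cs Hcs].
      - intros k. apply NNPP. intros Hk. apply Hfib. exists k. intros cs.
        apply NNPP. intros Hc. apply Hk. exists cs. intros c Hc1 Hc2.
        apply NNPP. intros Hc3. apply Hc. exists c. auto.
      - intros c Hc. apply Z.nlt_ge. intros Hlt. apply Hn. exists (bideg c).
        split; [exists c; auto | exact Hlt].
      - exists (map inl cs). intros s Hs. destruct (HB s Hs) as [c ->].
        apply in_map, Hcs, Hs. }
    destruct (sparse_subsequence _ Hub) as (d & Hd & HBd).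
    destruct (Hlim d Hd) as (x & Hx & Hacc).
    exists (inr (exist _ x (or_introl Hx))). intros U HU HUx.
    destruct (nbhd_limit (exist _ x (or_introl Hx)) U) as (ths & eps & ks & He & H).
    { simpl. intros k ->. exact (HP k Hx). }
    { apply HU, HUx. }
    (* By [sparse_ge], [d i] exceeds [i] in absolute value, so from this index on it avoids [ks]. *)
    destruct (Hacc ths eps (list_max (map Z.abs_nat ks)) He) as (i & Hi & Hth).
    destruct (HBd i) as (c & Hc & Hci). exists (inl c).
    split; [exact Hc | ]. split; [ | discriminate]. apply H; rewrite Hci; [ | exact Hth].
    intros Hin. apply (in_map Z.abs_nat), in_list_max in Hin.
    pose proof (sparse_ge d Hd i). lia.
Qed.

Theorem theorem6p1 :
  exists (S : Type) (t : topology S) (m : S -> S -> S),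
    topological_semigroup t m /\ tychonoff t /\ countably_pracompact t /\
    exists f : bicyclic -> S,
      (forall x y, f x = f y -> x = y) /\
      (forall x y, f (bicyclic_mul x y) = m (f x) (f y)).
Proof.
  destruct positive_semigroup as (P & H1 & H2 & H3 & H4 & H5).
  assert (HP : admissible P) by (split; [ | split]; assumption).
  exists (extension P), (initial_topology test), (ext_mul HP).
  split; [split; [ | split] | split; [ | split]].
  - apply initial_hausdorff, test_separates.
  - apply ext_mul_continuous.
  - apply ext_mul_assoc.
  - apply initial_tychonoff, test_separates.
  - apply extension_pracompact; assumption.
  - exists inl. split; [ | reflexivity]. intros x y H. injection H. auto.
Qed.
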